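(* Let $F_{\alpha,\beta}=\{f^n_{\alpha(n),\beta(n)}\}_{n\in\mathbb{N}}$ be a Fučík system with $\alpha(n)=\beta(n)=n^2$ for every odd $n$. If the mappings $\alpha$ and $\beta$ satisfy $$ \sum_{n=2}^\infty\left(\frac{\max(\sqrt{\alpha(n)},\sqrt{\beta(n)})}{n}-1\right)^2<\infty, $$ then $F_{\alpha,\beta}$ is a Riesz basis in $L^2(0,\pi)$.
   Context: Consider the boundary value problem $-u''(x)=\alpha u^+(x)-\beta u^-(x)$ in $(0,\pi)$, $u(0)=u(\pi)=0$, where $u^+=\max(u,0)$, $u^-=\max(-u,0)$, and $\alpha,\beta$ are real parameters. For $\alpha,\beta>0$ define the curves: for even $n\ge 2$, $$\Gamma_n=\Big\{(\alpha,\beta):\ \tfrac{n}{2}\tfrac{\pi}{\sqrt{\alpha}}+\tfrac{n}{2}\tfrac{\pi}{\sqrt{\beta}}=\pi\Big\},$$ and for odd $n\ge 3$, $$\Gamma_n=\Big\{(\alpha,\beta):\ \tfrac{n+1}{2}\tfrac{\pi}{\sqrt{\alpha}}+\tfrac{n-1}{2}\tfrac{\pi}{\sqrt{\beta}}=\pi\Big\}.$$ Normalized Fučík eigenfunction: for $n\ge2$ and $(\alpha,\beta)\in\Gamma_n$, $f^n_{\alpha,\beta}$ is the $C^2$-solution of the boundary value problem $-u''=\alpha u^+-\beta u^-$ in $(0,\pi)$, $u(0)=u(\pi)=0$, with $(f^n_{\alpha,\beta})'(0)>0$ and $\sup_{x\in[0,\pi]}|f^n_{\alpha,\beta}(x)|=1$.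 Explicitly, with $l_1=\pi/\sqrt{\alpha}$, $l_2=\pi/\sqrt{\beta}$, $l=l_1+l_2$, $k\in\{0,1,2,\dots\}$: if $\alpha\ge n^2\ge\beta$, then $f^n_{\alpha,\beta}(x)=\frac{\sqrt{\beta}}{\sqrt{\alpha}}\sin(\sqrt{\alpha}(x-kl))$ for $kl\le x<kl+l_1$ and $f^n_{\alpha,\beta}(x)=-\sin(\sqrt{\beta}(x-kl-l_1))$ for $kl+l_1\le x<(k+1)l$; if $\beta>n^2>\alpha$, then $f^n_{\alpha,\beta}(x)=\sin(\sqrt{\alpha}(x-kl))$ for $kl\le x<kl+l_1$ and $f^n_{\alpha,\beta}(x)=-\frac{\sqrt{\alpha}}{\sqrt{\beta}}\sin(\sqrt{\beta}(x-kl-l_1))$ for $kl+l_1\le x<(k+1)l$. For $n=1$, $f^1_{\alpha,\beta}(x)=\sin x$. (For $\alpha=\beta=n^2$ one has $f^n_{\alpha,\beta}(x)=\sin(nx)$.) Fučík system: a sequence $F_{\alpha,\beta}=\{f^n_{\alpha(n),\beta(n)}\}_{n\in\mathbb{N}}$ of normalized Fučík eigenfunctions, where $\alpha,\beta:\mathbb{N}\to\mathbb{R}$ satisfy $\alpha(1)=\beta(1)=1$ and $(\alpha(n),\beta(n))\in\Gamma_n$ for every $n\ge2$. Riesz basis: a system $\{\psi_n\}_{n\in\mathbb{N}}$ in $L^2(0,\pi)$ that is complete (its linear span is dense in $L^2(0,\pi)$) and for which there are constants $c,C>0$ with $c\sum_{n=1}^N|a_n|^2\le\|\sum_{n=1}^N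 a_n\psi_n\|^2\le C\sum_{n=1}^N|a_n|^2$ for all $N\in\mathbb{N}$ and all scalars $a_1,\dots,a_N$, where $\|\cdot\|$ is the standard norm of $L^2(0,\pi)$. *)

(* Defs.v *)
From mathcomp Require Import all_boot all_order all_algebra.
From mathcomp Require Import all_classical all_reals all_analysis.
Set Implicit Arguments.
Unset Strict Implicit.
Unset Printing Implicit Defensive.
Import Order.TTheory GRing.Theory Num.Theory.
Import numFieldNormedType.Exports.
Local Open Scope classical_set_scope.
Local Open Scope ring_scope.

(* Systems indexed by {1, 2, ...} are encoded as sequences on [nat] whose
   value at index 0 is never used. *)

Section fucik.
Variable R : realType.
Implicit Types (n : nat) (a b : R) (u : R -> R).

(* Used for n >= 2 only. *)
Definition fucik_curve n : set (R * R) :=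
  [set ab | [/\ 0 < ab.1, 0 < ab.2 &
    if odd n
    then n.+1%:R / 2 * (pi / Num.sqrt ab.1)
         + n.-1%:R / 2 * (pi / Num.sqrt ab.2) = pi
    else n%:R / 2 * (pi / Num.sqrt ab.1)
         + n%:R / 2 * (pi / Num.sqrt ab.2) = pi]].

(* u'(0) = d, the derivative at the endpoint 0 of [0, pi] being one-sided. *)
Definition right_derivative_at0 u (d : R) : Prop :=
  (fun h : R => h^-1 * (u h - u 0)) @ 0^'+ --> d.

(* Classical solutions of - u'' = a u^+ - b u^- with Dirichlet conditions. Only
   the values of u on [0, pi] matter. By the equation, u'' extends continuously
   to [0, pi], so that u is C^2 up to the boundary. *)
Definition fucik_solution a b u : Prop :=
  [/\ {within `[0, pi], continuous u},
      {in `]0, pi[, forall x,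
        [/\ derivable u x 1, derivable (derive1 u) x 1 &
            {for x, continuous (derive1 (derive1 u))}]},
      {in `]0, pi[, forall x, - derive1 (derive1 u) x = a * u^\+ x - b * u^\- x},
      u 0 = 0 & u pi = 0].

Definition normalized_fucik_eigenfunction a b u : Prop :=
  [/\ fucik_solution a b u,
      (exists2 d : R, 0 < d & right_derivative_at0 u d) &
      sup [set `|u x| | x in `[0, pi]] = 1].

Definition fucik_system (alpha beta : nat -> R) (f : nat -> R -> R) : Prop :=
  [/\ alpha 1%N = 1 /\ beta 1%N = 1,
      (forall n, (2 <= n)%N -> fucik_curve n (alpha n, beta n)),
      {in `[0, pi], f 1%N =1 sin} &
      (forall n, (2 <= n)%N ->
        normalized_fucik_eigenfunction (alpha n) (beta n) (f n))].

End fucik.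

Section riesz_basis.
Context d (T : measurableType d) (R : realType).
Variable mu : {measure set T -> \bar R}.
Implicit Types (psi : nat -> T -> R) (a : nat -> R).

Definition lin_comb psi a (N : nat) : T -> R :=
  fun x => \sum_(1 <= n < N.+1) a n * psi n x.

(* The linear span of psi is dense in L^2(mu). *)
Definition complete_system psi : Prop :=
  forall g : T -> R, g \in Lfun mu 2%:E ->
  forall e : R, 0 < e ->
  exists (N : nat) a,
    ('N[mu]_2%:E[EFin \o (g \- lin_comb psi a N)%R] < e%:E)%E.

Definition riesz_basis psi : Prop :=
  [/\ (forall n, (0 < n)%N -> psi n \in Lfun mu 2%:E),
      complete_system psi &
      exists c C : R, [/\ 0 < c, 0 < C & forall (N : nat) a,
        ((c * \sum_(1 <= n < N.+1) a n ^+ 2)%R%:E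
           <= 'N[mu]_2%:E[EFin \o lin_comb psi a N] ^+ 2
           <= (C * \sum_(1 <= n < N.+1) a n ^+ 2)%R%:E)%E]].

End riesz_basis.

(* L^2(0, pi) is L^2 of the real line for Lebesgue measure restricted to
   ]0, pi[. *)
Definition lebesgue_0pi (R : realType) :
    {measure set (measurableTypeR R) -> \bar R} :=
  mrestr (@lebesgue_measure R) (measurable_itv `]0, pi[).

(* A function is identified with its restriction to ]0, pi[, extended by 0, so
   that no measurability is required of its values off ]0, pi[. *)
Definition riesz_basis_0pi (R : realType) (f : nat -> R -> R) : Prop :=
  riesz_basis (@lebesgue_0pi R) (fun n => f n \_ `]0, pi[).

(* Main.v *)
(* The functions sin (n x) form an orthogonal basis of L2(0, pi), and on [0, pi]
   the eigenfunctions satisfy |f_n - sin (n x)| <= 6 (max (sqrt alpha_n)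
   (sqrt beta_n) / n - 1) for even n, so the hypothesis makes the system
   quadratically close to the sine basis. Beyond some index M the perturbation
   is too small to matter. For the finitely many indices below M, odd n gives
   f_n = sin (n x), while for even n the function f_n has period 2 pi / n:
   it is orthogonal to sin (m x) for every even m < n, and its product with
   sin (n x) has a positive integral. Relative to the sine basis, the f_n of
   even index are thus in triangular position, and those below M are dealt with
   one at a time, downwards from M. *)

Require Import Defs.
From mathcomp Require Import all_boot all_order all_algebra.
From mathcomp Require Import all_classical all_reals all_analysis measurable_realfun.
From mathcomp Require Import ring lra.
Import Order.TTheory GRing.Theory Num.Theory.
Import numFieldNormedType.Exports.
Local Open Scope classical_set_scope.
Local Open Scope ring_scope.


(** * Perturbation of an orthogonal basis *)

(** The perturbations below M need not be small, so a contraction argument cannot absorb them: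
    there, invertibility comes from the triangular position alone. Triangularity requires a whole
    number of periods in [0, pi], which an even index provides: the integral over the translates of
    one period then produces sums over the powers of a nontrivial k-th root of unity. An even f_n
    may correlate with odd sines, but this is harmless: at odd indices the system and the sine basis
    agree, so orthogonality conditions are imposed and corrected at even indices only. The threshold
    defining M is a tail at most kappa / 4, where kappa = pi / 2 is the squared norm of each sine:
    by Cauchy-Schwarz the perturbation of a combination is then at most half the norm of the
    unperturbed combination. The abstract argument handles finite combinations in a space that is
    only semi-normed, so explicit approximations are iterated instead of inverting a bounded
    operator. *)

Section semi_inner_product.
Context {R : realType} {V : lmodType R} (ip : V -> V -> R).

(** Definiteness is left out because L2 is used below as a space of functions rather than of
    classes, where a nonzero function can have norm 0. *)
Record semi_inner_product : Prop := SemiInnerProduct {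
  ipC : forall x y, ip x y = ip y x;
  ipDl : forall x y z, ip (x + y) z = ip x z + ip y z;
  ipZl : forall a x y, ip (a *: x) y = a * ip x y;
  ip_ge0 : forall x, 0 <= ip x x }.

Definition ip_norm x := Num.sqrt (ip x x).

Hypothesis ipP : semi_inner_product.

Lemma ipDr x y z : ip x (y + z) = ip x y + ip x z.
Proof. by rewrite ipC// ipDl// !(ipC ipP x). Qed.

Lemma ipZr a x y : ip x (a *: y) = a * ip x y.
Proof. by rewrite ipC// ipZl// (ipC ipP x). Qed.

Lemma ip0l x : ip 0 x = 0.
Proof. by rewrite -(scale0r 0) ipZl// mul0r. Qed.

Lemma ip_suml (I : Type) (r : seq I) (P : pred I) (F : I -> V) x :
  ip (\sum_(i <- r | P i) F i) x = \sum_(i <- r | P i) ip (F i) x.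
Proof.
by apply: (big_morph (fun y => ip y x)) => [y z|]; [rewrite ipDl|rewrite ip0l].
Qed.

Lemma ip_sumr (I : Type) (r : seq I) (P : pred I) (F : I -> V) x :
  ip x (\sum_(i <- r | P i) F i) = \sum_(i <- r | P i) ip x (F i).
Proof. by rewrite ipC// ip_suml; apply: eq_bigr => i _; rewrite ipC. Qed.

Lemma ip_normZ a x : ip_norm (a *: x) = `|a| * ip_norm x.
Proof.
by rewrite /ip_norm ipZl// ipZr mulrA -expr2 sqrtrM ?sqr_ge0// sqrtr_sqr.
Qed.

Lemma ip_norm_ge0 x : 0 <= ip_norm x.
Proof. exact: sqrtr_ge0. Qed.

Lemma ip_norm_sqr x : ip_norm x ^+ 2 = ip x x.
Proof. by rewrite sqr_sqrtr// ip_ge0. Qed.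

Lemma ip_lin_sqr a x y :
  ip (x + a *: y) (x + a *: y) = ip x x + 2 * a * ip x y + a ^+ 2 * ip y y.
Proof.
by rewrite !ipDl// !ipDr !ipZl// !ipZr (ipC ipP y x); ring.
Qed.

Lemma ip_cauchy_schwarz_sqr x y : ip x y ^+ 2 <= ip x x * ip y y.
Proof.
have h a : 0 <= ip x x + 2 * a * ip x y + a ^+ 2 * ip y y.
  by rewrite -ip_lin_sqr; exact: ip_ge0.
have [y0|y0] := eqVneq (ip y y) 0.
  rewrite y0 mulr0.
  suff -> : ip x y = 0 by rewrite expr0n.
  apply/eqP; apply: contraT => xy0.
  (* With [ip y y = 0] the quadratic is affine in [a]; this argument makes it equal to -1. *)
  have := h (- (ip x x + 1) / (2 * ip x y)); rewrite y0 mulr0 addr0.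
  suff -> : 2 * (- (ip x x + 1) / (2 * ip x y)) * ip x y = - (ip x x + 1) by lra.
  by field; rewrite xy0.
have yp : 0 < ip y y by rewrite lt_neqAle eq_sym y0 ip_ge0.
(* This is the minimiser of the quadratic. *)
have := h (- (ip x y) / ip y y).
suff -> : ip x x + 2 * (- ip x y / ip y y) * ip x y +
    (- ip x y / ip y y) ^+ 2 * ip y y = (ip x x * ip y y - ip x y ^+ 2) / ip y y.
  by rewrite pmulr_lge0 ?invr_gt0// subr_ge0.
by field.
Qed.

Lemma ip_cauchy_schwarz x y : ip x y <= ip_norm x * ip_norm y.
Proof.
rewrite (le_trans (ler_norm _))// -(ler_pXn2r (n := 2))// ?nnegrE ?mulr_ge0 ?ip_norm_ge0//.
by rewrite exprMn !ip_norm_sqr real_normK ?num_real// ip_cauchy_schwarz_sqr.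
Qed.

Lemma ip_normD x y : ip_norm (x + y) <= ip_norm x + ip_norm y.
Proof.
rewrite -(ler_pXn2r (n := 2))// ?nnegrE ?addr_ge0 ?ip_norm_ge0//.
rewrite ip_norm_sqr -[y]scale1r ip_lin_sqr scale1r sqrrD !ip_norm_sqr.
have := ip_cauchy_schwarz x y; lra.
Qed.

Lemma ip_norm_sum (I : Type) (r : seq I) (P : pred I) (F : I -> V) :
  ip_norm (\sum_(i <- r | P i) F i) <= \sum_(i <- r | P i) ip_norm (F i).
Proof.
elim/big_rec2: _ => [|i y x _ h]; first by rewrite /ip_norm ip0l sqrtr0.
by rewrite (le_trans (ip_normD _ _))// lerD2l.
Qed.

End semi_inner_product.

Lemma sum_cauchy_schwarz {R : realType} (I : Type) (r : seq I) (P : pred I) (a b : I -> R) :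
  \sum_(i <- r | P i) a i * b i <=
  Num.sqrt (\sum_(i <- r | P i) a i ^+ 2) * Num.sqrt (\sum_(i <- r | P i) b i ^+ 2).
Proof.
pose ip (f g : I -> R^o) : R := \sum_(i <- r | P i) f i * g i.
have ipP : semi_inner_product ip.
  split=> [x y|x y z|c x y|x]; rewrite /ip.
  - by apply: eq_bigr => i _; rewrite mulrC.
  - by rewrite -big_split; apply: eq_bigr => i _; rewrite mulrDl.
  - by rewrite big_distrr; apply: eq_bigr => i _; exact/esym/mulrA.
  - by apply: sumr_ge0 => i _; rewrite -expr2 sqr_ge0.
exact: (ip_cauchy_schwarz _ ipP).
Qed.

(** * Riesz basis property of a triangular, quadratically close perturbation *)

Section riesz_perturbation.
Context {R : realType} {V : lmodType R} (ip : V -> V -> R).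
Hypothesis ipP : semi_inner_product ip.
Local Notation nrm := (ip_norm ip).
Variables (kappa : R) (e psi : nat -> V) (P : pred nat).
Hypothesis kappa_gt0 : 0 < kappa.
Hypothesis e_orth : forall m n, (0 < m)%N -> (0 < n)%N ->
  ip (e m) (e n) = if m == n then kappa else 0.
Hypothesis e_dense : forall (x : V) (eta : R), 0 < eta ->
  exists N (b : nat -> R), nrm (x - \sum_(1 <= n < N.+1) b n *: e n) < eta.
Hypothesis psiNP : forall n, (0 < n)%N -> ~~ P n -> psi n = e n.
Hypothesis psi_triangular : forall m n, (0 < m < n)%N -> P m -> P n ->
  ip (psi n) (e m) = 0.
Hypothesis psi_diag : forall n, (0 < n)%N -> P n -> ip (psi n) (e n) != 0.
Hypothesis psi_close : forall eta : R, 0 < eta -> exists M, forall N,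
  \sum_(M <= n < N) ip (psi n - e n) (psi n - e n) <= eta.

Lemma psi_neq_orth m n : (0 < m)%N -> (0 < n)%N -> P m -> n != m ->
  (P n -> m < n)%N -> ip (psi n) (e m) = 0.
Proof.
move=> m0 n0 Pm nm Pnm; have [Pn|Pn] := boolP (P n).
  by rewrite psi_triangular// m0 Pnm.
by rewrite psiNP// e_orth// (negbTE nm).
Qed.

Lemma ip_sum_e (b : nat -> R) N m : (0 < m)%N ->
  ip (\sum_(1 <= n < N.+1) b n *: e n) (e m) = if (m < N.+1)%N then b m * kappa else 0.
Proof.
move=> m0; rewrite ip_suml//.
have h i : i != m -> (1 <= i)%N -> ip (b i *: e i) (e m) = 0.
  by move=> im i1; rewrite ipZl// e_orth// (negbTE im) mulr0.
case: ifPn => mN.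
  rewrite (bigD1_seq m)/= ?mem_index_iota ?m0 ?iota_uniq//.
  rewrite big_nat_cond big1 ?addr0 ?ipZl// ?e_orth// ?eqxx// => i /andP[/andP[i1 _] im].
  exact: h.
rewrite big_nat_cond big1// => i; rewrite andbT => /andP[i1 iN]; apply: h => //.
by apply: contraNneq mN => <-.
Qed.

Lemma ip_sum_e_sqr (b : nat -> R) N :
  ip (\sum_(1 <= n < N.+1) b n *: e n) (\sum_(1 <= n < N.+1) b n *: e n) =
  kappa * \sum_(1 <= n < N.+1) b n ^+ 2.
Proof.
rewrite ip_sumr// big_distrr/=; apply: eq_big_nat => m /andP[m1 mN].
by rewrite ipZr// ip_sum_e// mN; ring.
Qed.

(** The Fourier remainder [x - S] is orthogonal to the span of the first [N] vectors, which contains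
    [S - D]. Taking [b = 0] gives Bessel; arbitrary [b] gives optimality of the Fourier
    coefficients. *)
Lemma fourier_pythagoras x N (b : nat -> R) :
  let c n := ip x (e n) / kappa in
  ip (x - \sum_(1 <= n < N.+1) b n *: e n) (x - \sum_(1 <= n < N.+1) b n *: e n) =
  ip (x - \sum_(1 <= n < N.+1) c n *: e n) (x - \sum_(1 <= n < N.+1) c n *: e n) +
  kappa * \sum_(1 <= n < N.+1) (c n - b n) ^+ 2.
Proof.
move=> c; set S := \sum_(_ <= _ < _) c _ *: _; set D := \sum_(_ <= _ < _) b _ *: _.
have DE : S - D = \sum_(1 <= n < N.+1) (c n - b n) *: e n.
  by rewrite /S /D -sumrB; apply: eq_bigr => i _; rewrite scalerBl.
have xS m : (0 < m < N.+1)%N -> ip (x - S) (e m) = 0.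
  move=> /andP[m0 mN]; rewrite ipDl// -scaleN1r ipZl// ip_sum_e// mN /c.
  by field; rewrite gt_eqF.
have o : ip (x - S) (S - D) = 0.
  rewrite DE ip_sumr// big_nat big1// => m mN.
  by rewrite ipZr// xS// mulr0.
rewrite (_ : x - D = (x - S) + 1 *: (S - D)); last first.
  by rewrite scale1r addrA subrK.
by rewrite ip_lin_sqr// o mulr0 addr0 expr1n mul1r DE ip_sum_e_sqr.
Qed.

Lemma bessel x N :
  kappa * \sum_(1 <= n < N.+1) (ip x (e n) / kappa) ^+ 2 <= ip x x.
Proof.
have := fourier_pythagoras x N (fun _ => 0) => /=.
rewrite [X in x - X](_ : _ = 0); last by apply: big1 => i _; rewrite scale0r.
rewrite subr0 => ->; rewrite -[leLHS]add0r lerD ?ip_ge0//.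
by under eq_bigr do rewrite -[X in X ^+ 2](subr0 (ip x (e _) / kappa)).
Qed.

(** Replacing the coefficients given by density with Fourier coefficients matters later: the latter
    vanish wherever [x] is orthogonal to [e n]. *)
Lemma fourier_dense x (eta : R) : 0 < eta -> exists N,
  nrm (x - \sum_(1 <= n < N.+1) (ip x (e n) / kappa) *: e n) < eta.
Proof.
move=> /e_dense -/(_ x)[N [b xb]]; exists N; apply: le_lt_trans xb.
rewrite /nrm ler_sqrt ?ip_ge0// (fourier_pythagoras x N b) lerDl.
by rewrite mulr_ge0 ?(ltW kappa_gt0)// sumr_ge0// => i _; rewrite sqr_ge0.
Qed.

Definition psi_span x := exists N (a : nat -> R),
  x = \sum_(1 <= n < N.+1) a n *: psi n.

Lemma psi_sum_widen N N' (a : nat -> R) : (N <= N')%N ->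
  \sum_(1 <= n < N.+1) a n *: psi n =
  \sum_(1 <= n < N'.+1) (if (n <= N)%N then a n else 0) *: psi n.
Proof.
move=> NN'; rewrite [RHS](big_cat_nat (n := N.+1))//=.
rewrite [X in _ = _ + X]big_nat [X in _ = _ + X]big1 ?addr0; last first.
  by move=> i /andP[Ni _]; rewrite leqNgt Ni scale0r.
by apply: eq_big_nat => i /andP[_]; rewrite ltnS => ->.
Qed.

Lemma psi_spanD x y : psi_span x -> psi_span y -> psi_span (x + y).
Proof.
move=> [N [a ->]] [N' [a' ->]].
rewrite (psi_sum_widen _ (maxn N N')) ?leq_maxl//.
rewrite [X in _ + X](psi_sum_widen _ (maxn N N')) ?leq_maxr//.
rewrite -big_split/=; eexists; eexists; apply: eq_bigr => i _.
by rewrite -scalerDl.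
Qed.

Lemma psi_spanZ c x : psi_span x -> psi_span (c *: x).
Proof.
move=> [N [a ->]]; exists N, (fun n => c * a n); rewrite scaler_sumr.
by apply: eq_bigr => i _; rewrite scalerA.
Qed.

Lemma psi_span_psi n : (0 < n)%N -> psi_span (psi n).
Proof.
move=> n0; exists n, (fun i => (i == n)%:R); rewrite big_nat_recr//=.
rewrite eqxx scale1r big_nat big1 ?add0r// => i /andP[_ iltn].
by rewrite ltn_eqF// scale0r.
Qed.

Definition psi_approx x := forall eta : R, 0 < eta ->
  exists2 y, psi_span y & nrm (x - y) < eta.

(** Only indices in [P] are constrained: at the others [psi] and [e] coincide. *)
Definition orth_upto M x := forall m, (0 < m < M)%N -> P m -> ip x (e m) = 0.

(** Below [M] every term vanishes, by its coefficient inside [P] and because [psi n = e n] outside.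
    The rest is the triangle inequality followed by Cauchy-Schwarz. *)
Lemma perturbation_le M N (a : nat -> R) (eta : R) : 0 <= eta ->
  (forall N', \sum_(M <= n < N') ip (psi n - e n) (psi n - e n) <= eta) ->
  (forall n, (n < M)%N -> P n -> a n = 0) ->
  nrm (\sum_(1 <= n < N.+1) a n *: (psi n - e n)) <=
  Num.sqrt (\sum_(1 <= n < N.+1) a n ^+ 2) * Num.sqrt eta.
Proof.
move=> eta0 tail a0.
have -> : \sum_(1 <= n < N.+1) a n *: (psi n - e n) =
    \sum_(1 <= n < N.+1 | (M <= n)%N) a n *: (psi n - e n).
  rewrite [RHS]big_mkcond/=; apply: eq_big_nat => n /andP[n1 _].
  case: ifPn => //; rewrite -ltnNge => nM; have [Pn|Pn] := boolP (P n).
    by rewrite a0// scale0r.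
  by rewrite psiNP// subrr scaler0.
apply: le_trans (ip_norm_sum _ ipP _ _ _ _) _.
under eq_bigr do rewrite ip_normZ//.
apply: (le_trans (sum_cauchy_schwarz _ _ _ (fun i => `|a i|) _)).
apply: ler_pM; rewrite ?sqrtr_ge0//.
  rewrite ler_sqrt ?sumr_ge0// => [|i _]; last by rewrite sqr_ge0.
  rewrite big_mkcond/= ler_sum// => i _; case: ifPn => _; last by rewrite sqr_ge0.
  by rewrite real_normK ?num_real.
rewrite ler_sqrt//; apply: le_trans (tail N.+1).
under eq_bigr do rewrite ip_norm_sqr//.
have h i : 0 <= ip (psi i - e i) (psi i - e i) by exact: ip_ge0.
(* For [M = 0] the bounded tail also contains index 0, which the sum on the left omits. *)
have [M0|M0] := posnP M.
  rewrite M0 [leRHS](big_cat_nat (n := 1))//=.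
  rewrite -[leLHS]add0r lerD// ?sumr_ge0//.
by rewrite [leRHS](big_nat_widenl M 1).
Qed.

(** The square root of [kappa / 4] is half the norm of each [e n]. *)
Lemma close_constant : exists2 M, (0 < M)%N & forall N,
  \sum_(M <= n < N) ip (psi n - e n) (psi n - e n) <= kappa / 4.
Proof.
have [|M hM] := psi_close (kappa / 4); first by rewrite divr_gt0.
exists M.+1 => // N; apply: le_trans (hM N).
by have [MN|MN] := ltnP M N;
  [rewrite [leRHS]big_ltn// lerDr ip_ge0 | rewrite !big_geq// ltnW].
Qed.

Lemma sqrt_kappa4 : Num.sqrt (kappa / 4) = Num.sqrt kappa / 2.
Proof.
rewrite sqrtrM ?(ltW kappa_gt0)//; congr (_ * _).
rewrite (_ : 4^-1 = (2^-1) ^+ 2 :> R); last by field.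
by rewrite sqrtr_sqr ger0_norm// invr_ge0.
Qed.

Section dense.
Variable M : nat.
Hypothesis M_tail : forall N,
  \sum_(M <= n < N) ip (psi n - e n) (psi n - e n) <= kappa / 4.

(* If x ~ sum b_n e_n, then x - sum b_n psi_n ~ - sum b_n (psi_n - e_n) is again
   orthogonal to the low e_m and has at most half the norm of x: iterate. *)
Lemma approx_step x k (eta : R) : orth_upto M x -> 0 < eta -> exists2 y, psi_span y &
  nrm (x - y) < (2^-1) ^+ k * nrm x + eta.
Proof.
elim: k x eta => [|k ih] x eta xM eta0.
  exists 0; last by rewrite subr0 expr0 mul1r ltrDl.
  by exists 0%N, (fun=> 0); rewrite big_geq.
have [|N] := fourier_dense x (eta / 2); first by rewrite divr_gt0.
set b := fun n => ip x (e n) / kappa.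
set S := \sum_(1 <= n < N.+1) _ => xS.
pose T := \sum_(1 <= n < N.+1) b n *: psi n.
have b0 n : (0 < n < M)%N -> P n -> b n = 0.
  by move=> nM Pn; rewrite /b xM// mul0r.
(* In [T], terms outside [P] are multiples of other [e n], terms of [P] below [M] have coefficient
   0, and the remaining ones are orthogonal to [e m] by triangularity. *)
have STM : orth_upto M (S - T).
  move=> m mM Pm; have /andP[m0 m_lt] := mM.
  rewrite ipDl// -scaleN1r ipZl// ip_sum_e//.
  rewrite (_ : ip T (e m) = 0); last first.
    rewrite ip_suml// big_nat_cond big1// => n; rewrite andbT => /andP[n1 nN].
    rewrite ipZl//; have [Pn|Pn] := boolP (P n); last first.
      by rewrite psi_neq_orth ?mulr0// ?(negbTE Pn)//; apply: contraNneq Pn => ->.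
    have [nM|nM] := ltnP n M; first by rewrite b0 ?mul0r// n1.
    by rewrite psi_triangular ?mulr0// m0 (leq_trans m_lt nM).
  by rewrite mulr0 addr0; case: ifP => // _; rewrite xM// !mul0r.
have [|y yspan hy] := ih (S - T) (eta / 2) STM; first by rewrite divr_gt0.
exists (T + y).
  by apply: psi_spanD => //; exists N, b.
rewrite (_ : x - (T + y) = (x - S) + (S - T - y)); last first.
  by rewrite opprD !addrA subrK.
apply: le_lt_trans (ip_normD _ ipP _ _) _.
suff STle : nrm (S - T) <= 2^-1 * nrm x.
  have : (2^-1) ^+ k * nrm (S - T) <= (2^-1) ^+ k.+1 * nrm x :> R.
    by rewrite exprSr -mulrA ler_wpM2l// exprn_ge0// invr_ge0.
  move: xS hy; rewrite -/S; set u := nrm _; set v := nrm _; set w := _ * nrm (S - T).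
  set z := _ * nrm x; lra.
have -> : nrm (S - T) = nrm (\sum_(1 <= n < N.+1) b n *: (psi n - e n)).
  rewrite -[LHS]mul1r -(normr1 R) -normrN -ip_normZ//; congr nrm.
  rewrite scaleN1r opprB /T /S -sumrB; apply: eq_bigr => i _.
  by rewrite scalerBr.
(* [perturbation_le] also asks for a zero coefficient at index 0, which no sum contains, so [b] is
   reset there. *)
pose b' n := if n is 0%N then 0 else b n.
have -> : \sum_(1 <= n < N.+1) b n *: (psi n - e n) =
          \sum_(1 <= n < N.+1) b' n *: (psi n - e n).
  by apply: eq_big_nat => -[|n].
have b'0 n : (n < M)%N -> P n -> b' n = 0 by case: n => // n nM; exact: b0.
apply: le_trans (perturbation_le M N b' (kappa / 4) _ M_tail b'0) _.
  by rewrite divr_ge0// ltW.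
have -> : \sum_(1 <= n < N.+1) b' n ^+ 2 = \sum_(1 <= n < N.+1) b n ^+ 2.
  by apply: eq_big_nat => -[|n].
rewrite sqrt_kappa4 mulrA mulrC ler_wpM2l ?invr_ge0// -sqrtrM; last first.
  by rewrite sumr_ge0// => i _; rewrite sqr_ge0.
by rewrite ler_sqrt ?ip_ge0// mulrC bessel.
Qed.

Lemma approx_orth x : orth_upto M x -> psi_approx x.
Proof.
move=> xM eta eta0.
have [k hk] : exists k, (2^-1) ^+ k * nrm x < eta / 2.
  (* Adding 1 allows the division even when the norm of [x] is 0. *)
  have x1 : 0 < nrm x + 1 by rewrite ltr_wpDl// ip_norm_ge0.
  have h0 : 0 < eta / 2 / (nrm x + 1) by rewrite !divr_gt0.
  have := @cvg_expr R 2^-1; rewrite ger0_norm ?invr_ge0// invf_lt1// ltr1n.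
  move=> /(_ isT)/cvgrPdist_lt/(_ _ h0)[k _ /(_ k (leqnn k))]/=.
  rewrite sub0r normrN ger0_norm ?exprn_ge0 ?invr_ge0// ltr_pdivlMr// => hk.
  exists k; apply: le_lt_trans hk.
  by rewrite ler_wpM2l ?exprn_ge0 ?invr_ge0// lerDl.
have [|y ys hy] := approx_step x k (eta / 2) xM; first by rewrite divr_gt0.
by exists y => //; move: hk hy; lra.
Qed.

(** Each step frees one index [m]: subtracting the right multiple of [psi m] kills the product with
    [e m], and by triangularity leaves the products with lower [e j] at 0. At [k = M] no condition
    on [x] remains. *)
Lemma approx_downward k x : orth_upto (M - k) x -> psi_approx x.
Proof.
elim: k x => [|k ih] x; first by rewrite subn0; exact: approx_orth.
have [kM|kM] := ltnP k M; last first.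
  have Mk : (M - k = 0)%N by apply/eqP; rewrite subn_eq0.
  have Mk1 : (M - k.+1 = 0)%N by apply/eqP; rewrite subn_eq0 leqW.
  by rewrite Mk1 => x0; apply: ih; rewrite Mk.
set m := (M - k.+1)%N; have mE : (M - k)%N = m.+1 by rewrite /m subnSK.
rewrite mE in ih => xm.
have [/andP[m0 Pm]|] := boolP ((0 < m)%N && P m); last first.
  move=> nm; apply: ih => j /andP[j0]; rewrite ltnS leq_eqVlt => /orP[/eqP jm Pj|jm].
    by move: nm; rewrite -jm j0 Pj.
  by apply: xm; rewrite j0.
pose c := ip x (e m) / ip (psi m) (e m).
move=> eta eta0.
have xcm : orth_upto m.+1 (x - c *: psi m).
  move=> j /andP[j0]; rewrite ltnS leq_eqVlt => /orP[/eqP jm Pj|jm Pj].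
    by rewrite jm ipDl// -scaleNr ipZl// /c; field; rewrite psi_diag.
  by rewrite ipDl// -scaleNr ipZl// xm ?j0// psi_triangular ?mulr0 ?addr0// j0.
have [y ys hy] := ih _ xcm _ eta0.
exists (c *: psi m + y); last by rewrite opprD addrA.
by apply: psi_spanD => //; apply: psi_spanZ; exact: psi_span_psi.
Qed.

End dense.

Lemma psi_dense x (eta : R) : 0 < eta ->
  exists N (a : nat -> R), nrm (x - \sum_(1 <= n < N.+1) a n *: psi n) < eta.
Proof.
move=> eta0; have [M _ hM] := close_constant.
have [|y [N [a ->]] h] := approx_downward M hM M x _ eta eta0; last by exists N, a.
by rewrite subnn => -[].
Qed.

Lemma psi_sum_split N (a : nat -> R) :
  \sum_(1 <= n < N.+1) a n *: psi n =
  \sum_(1 <= n < N.+1) a n *: e n + \sum_(1 <= n < N.+1) a n *: (psi n - e n).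
Proof.
by rewrite -big_split; apply: eq_bigr => i _/=; rewrite scalerBr addrC subrK.
Qed.

Lemma nrm_sum_e N (a : nat -> R) :
  nrm (\sum_(1 <= n < N.+1) a n *: e n) =
  Num.sqrt kappa * Num.sqrt (\sum_(1 <= n < N.+1) a n ^+ 2).
Proof. by rewrite /ip_norm ip_sum_e_sqr sqrtrM// ltW. Qed.

Lemma sum_sqr_ge0 N (a : nat -> R) : 0 <= \sum_(1 <= n < N.+1) a n ^+ 2.
Proof. by rewrite sumr_ge0// => i _; rewrite sqr_ge0. Qed.

(** Adding the finitely many terms below [M] to the tail bounds all partial sums of the squared
    perturbations by one constant [B], so [perturbation_le] applies from index 0, where no
    coefficient needs to vanish. *)
Lemma psi_upper : exists2 C, 0 < C & forall N (a : nat -> R),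
  ip (\sum_(1 <= n < N.+1) a n *: psi n) (\sum_(1 <= n < N.+1) a n *: psi n)
  <= C * \sum_(1 <= n < N.+1) a n ^+ 2.
Proof.
have [M M0 hM] := close_constant.
pose B := \sum_(0 <= n < M) ip (psi n - e n) (psi n - e n) + kappa / 4.
have h i : 0 <= ip (psi i - e i) (psi i - e i) by exact: ip_ge0.
have B0 : 0 <= B by rewrite addr_ge0 ?sumr_ge0// divr_ge0// ltW.
have hB N : \sum_(0 <= n < N) ip (psi n - e n) (psi n - e n) <= B.
  have [NM|NM] := leqP N M.
    rewrite /B [in leRHS](big_cat_nat (n := N))//= -addrA lerDl addr_ge0 ?sumr_ge0//.
    by rewrite divr_ge0// ltW.
  by rewrite /B (big_cat_nat (n := M)) ?(ltnW NM)//= lerD2l.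
exists ((Num.sqrt kappa + Num.sqrt B) ^+ 2).
  by rewrite exprn_gt0// ltr_pwDl ?sqrtr_gt0// sqrtr_ge0.
move=> N a; rewrite -ip_norm_sqr// -[X in _ * X]sqr_sqrtr ?sum_sqr_ge0//.
rewrite -exprMn ler_pXn2r// ?nnegrE ?ip_norm_ge0 ?mulr_ge0 ?addr_ge0 ?sqrtr_ge0//.
rewrite psi_sum_split; apply: le_trans (ip_normD _ ipP _ _) _.
rewrite mulrDl lerD// ?nrm_sum_e// mulrC.
exact: (perturbation_le 0 N a B).
Qed.

(** Invariant of a downward induction on [m]; at [m = 0] it is the full lower bound. *)
Definition lower_from m := exists2 c, 0 < c & forall N (a : nat -> R),
  (forall j, (j < m)%N -> P j -> a j = 0) ->
  c * \sum_(1 <= n < N.+1) a n ^+ 2 <=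
  ip (\sum_(1 <= n < N.+1) a n *: psi n) (\sum_(1 <= n < N.+1) a n *: psi n).

(** The perturbation takes away at most half of the norm of the combination of the [e n]. *)
Lemma lower_from_tail M : (forall N,
    \sum_(M <= n < N) ip (psi n - e n) (psi n - e n) <= kappa / 4) ->
  lower_from M.
Proof.
move=> hM; exists (kappa / 4); first by rewrite divr_gt0.
move=> N a aM; rewrite -ip_norm_sqr// -[X in _ * X]sqr_sqrtr ?sum_sqr_ge0//.
rewrite -[kappa / 4]sqr_sqrtr ?divr_ge0 ?(ltW kappa_gt0)//.
rewrite -exprMn ler_pXn2r// ?nnegrE ?ip_norm_ge0 ?mulr_ge0 ?sqrtr_ge0//.
rewrite sqrt_kappa4.
have := perturbation_le M N a (kappa / 4) _ hM aM.
rewrite sqrt_kappa4 divr_ge0 ?(ltW kappa_gt0)// => /(_ isT).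
have := ip_normD _ ipP (\sum_(1 <= n < N.+1) a n *: psi n)
   (- 1 *: \sum_(1 <= n < N.+1) a n *: (psi n - e n)).
rewrite ip_normZ// normrN normr1 mul1r scaleN1r {1}psi_sum_split addrK nrm_sum_e.
set s := Num.sqrt kappa; set t := Num.sqrt _; set u := nrm _; set v := nrm _.
lra.
Qed.

(* By triangularity, pairing a combination whose low coefficients vanish with e_m
   isolates a_m, which is therefore controlled by the norm of the combination. *)
Lemma lower_from_step m : lower_from m.+1 -> lower_from m.
Proof.
move=> [c c0 hc].
have [/andP[m0 Pm]|nm] := boolP ((0 < m)%N && P m); last first.
  exists c => // N a am.
  (* When [m = 0], [hc] may constrain index 0, which no sum contains: the coefficient is reset
     there. *)
  pose a' n := if n is 0%N then 0 else a n.
  have a'E (W : lmodType R) (F : nat -> W) :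
    \sum_(1 <= n < N.+1) a n *: F n = \sum_(1 <= n < N.+1) a' n *: F n.
    by apply: eq_big_nat => -[|n].
  rewrite a'E.
  have -> : \sum_(1 <= n < N.+1) a n ^+ 2 = \sum_(1 <= n < N.+1) a' n ^+ 2.
    by apply: eq_big_nat => -[|n].
  apply: hc => -[//|j] /=; rewrite ltnS leq_eqVlt => /orP[/eqP jm Pj|jm]; last exact: am.
  by move: nm; rewrite -jm Pj.
pose D := ip (psi m) (e m); have D0 : D != 0 by exact: psi_diag.
have D2 : 0 < D ^+ 2 by rewrite lt_neqAle eq_sym sqrf_eq0 D0 sqr_ge0.
pose Q := ip (psi m) (psi m); have Q0 : 0 <= Q by exact: ip_ge0.
(* The second summand bounds the square of the isolated coefficient, the first the other
   coefficients, both relative to [ip h h]. *)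
pose L := (2 + 2 * Q * (kappa / D ^+ 2)) / c + kappa / D ^+ 2.
have kD : 0 < kappa / D ^+ 2 by rewrite divr_gt0.
have L0 : 0 < L.
  rewrite ltr_pwDr// divr_ge0// ?(ltW c0)// addr_ge0// mulr_ge0// ?(ltW kD)// mulr_ge0//.
exists L^-1; first by rewrite invr_gt0.
move=> N a am; rewrite ler_pdivrMl//.
(* The combination may stop before index [m]; its coefficient there is then 0. *)
pose t := if (m < N.+1)%N then a m else 0.
pose a' n := if n == m then 0 else a n.
set h := \sum_(_ <= _ < _) _ *: _.
pose h' := \sum_(1 <= n < N.+1) a' n *: psi n.
have hE : h = h' + t *: psi m.
  rewrite /h /h' /t; case: ifPn => mN.
    rewrite (bigD1_seq m)/= ?mem_index_iota ?m0 ?iota_uniq//.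
    rewrite [X in _ = X + _](bigD1_seq m)/= ?mem_index_iota ?m0 ?iota_uniq//.
    rewrite {1}/a' eqxx scale0r add0r addrC; congr (_ + _).
    by apply: eq_bigr => i /negbTE im; rewrite /a' im.
  rewrite scale0r addr0; apply: eq_big_nat => i /andP[_ iN].
  by rewrite /a' ifN//; apply: contraNneq mN => <-.
have sE : \sum_(1 <= n < N.+1) a n ^+ 2 = \sum_(1 <= n < N.+1) a' n ^+ 2 + t ^+ 2.
  rewrite /t; case: ifPn => mN.
    rewrite (bigD1_seq m)/= ?mem_index_iota ?m0 ?iota_uniq//.
    rewrite [X in _ = X + _](bigD1_seq m)/= ?mem_index_iota ?m0 ?iota_uniq//.
    rewrite {1}/a' eqxx expr0n add0r addrC; congr (_ + _).
    by apply: eq_bigr => i /negbTE im; rewrite /a' im.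
  rewrite expr0n addr0; apply: eq_big_nat => i /andP[_ iN].
  by rewrite /a' ifN//; apply: contraNneq mN => <-.
have a'm j : (j < m.+1)%N -> P j -> a' j = 0.
  rewrite /a' ltnS leq_eqVlt => /orP[->//|jm Pj].
  by rewrite am//; case: ifP.
have h'e : ip h' (e m) = 0.
  rewrite ip_suml// big_nat_cond big1// => n; rewrite andbT => /andP[n1 nN].
  rewrite ipZl//; have [nm|nm] := eqVneq n m; first by rewrite /a' nm eqxx mul0r.
  have [Pn|Pn] := boolP (P n); last by rewrite psi_neq_orth ?mulr0// (negbTE Pn).
  have [ltnm|lemn] := ltnP n m; first by rewrite a'm ?mul0r// ltnW.
  by rewrite psi_triangular ?mulr0// m0 ltn_neqAle eq_sym nm.
have ht : ip h (e m) = t * D by rewrite hE ipDl// h'e add0r ipZl.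
have t2 : t ^+ 2 <= kappa / D ^+ 2 * ip h h.
  rewrite mulrAC ler_pdivlMr// -exprMn -ht mulrC.
  by rewrite (le_trans (ip_cauchy_schwarz_sqr _ ipP _ _))// e_orth// eqxx.
(* Parallelogram law: the square of [h + t *: psi m] is nonnegative. *)
have h'2 : ip h' h' <= 2 * ip h h + 2 * Q * t ^+ 2.
  have -> : h' = h + (- t) *: psi m by rewrite hE scaleNr addrK.
  rewrite ip_lin_sqr//.
  have := ip_ge0 _ ipP (h + t *: psi m); rewrite ip_lin_sqr// -/Q.
  rewrite sqrrN; set u := ip h h; set v := ip h (psi m); lra.
have := hc N a' a'm; rewrite -/h' => h'c.
rewrite sE.
have {}h'c : \sum_(1 <= n < N.+1) a' n ^+ 2 <=
    (2 + 2 * Q * (kappa / D ^+ 2)) / c * ip h h.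
  rewrite mulrAC ler_pdivlMr// mulrC (le_trans h'c)// (le_trans h'2)//.
  by rewrite [leRHS]mulrDl lerD2l -[leRHS]mulrA ler_wpM2l// mulr_ge0.
by rewrite /L mulrDl lerD.
Qed.

Lemma psi_lower : exists2 c, 0 < c & forall N (a : nat -> R),
  c * \sum_(1 <= n < N.+1) a n ^+ 2 <=
  ip (\sum_(1 <= n < N.+1) a n *: psi n) (\sum_(1 <= n < N.+1) a n *: psi n).
Proof.
have [M _ hM] := close_constant.
have : lower_from 0.
  elim: M hM => [|M ih] hM; first exact: lower_from_tail.
  have lM : lower_from M.+1 by exact: lower_from_tail.
  move: lM {ih hM}; elim: M.+1 => // m ih lm; apply: ih; exact: lower_from_step.
by case=> c c0 hc; exists c => // N a; exact: hc.
Qed.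

End riesz_perturbation.

(** * Solutions of the Fucik equation *)

Section one_sided_derivative.
Context {R : realType}.
Implicit Types (u g : R -> R) (a b c d : R).

Definition right_derivative u a d :=
  (fun h : R => h^-1 * (u (a + h) - u a)) @ 0^'+ --> d.

Lemma is_derive_quotient u a d : is_derive a 1 u d ->
  (fun h : R => h^-1 * (u (a + h) - u a)) @ 0^' --> d.
Proof.
move=> [du <-]; move: du; rewrite /derivable /derive.
rewrite (_ : (fun h => _) = (fun h : R => h^-1 * (u (a + h) - u a)))//.
by apply/funext => h; rewrite /= [_%:A]mulr1 [h + a]addrC.
Qed.

Lemma is_derive_right u a d : is_derive a 1 u d -> right_derivative u a d.
Proof. by move=> /is_derive_quotient; exact: cvg_dnbhs_at_right. Qed.

Lemma right_derivative_unique u g a c d d' : a < c -> {in `[a, c[, u =1 g} ->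
  right_derivative u a d -> is_derive a 1 g d' -> d = d'.
Proof.
move=> ac ug ud /is_derive_right gd.
apply: (norm_cvg_unique ud) => //.
apply: cvg_trans gd; apply: near_eq_cvg; near=> h.
rewrite !ug// in_itv/= ?lexx//; apply/andP; split.
  by rewrite lerDl.
by rewrite -ltrBrDl; near: h; apply: nbhs_right_lt; rewrite subr_gt0.
Unshelve. all: by end_near. Qed.

(** Serves at the end of a bump, where [u] is differentiable but its explicit formula [g] holds on
    the left only. *)
Lemma left_derivative_unique u g a c d d' : a < c -> {in `]a, c], u =1 g} ->
  is_derive c 1 u d -> is_derive c 1 g d' -> d = d'.
Proof.
move=> ac ug /is_derive_quotient/cvg_dnbhs_at_left ud /is_derive_quotient/cvg_dnbhs_at_left gd.
apply: (norm_cvg_unique ud) => //.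
apply: cvg_trans gd; apply: near_eq_cvg; near=> h.
rewrite !ug// in_itv/= ?lexx ?ac//; apply/andP; split; last by rewrite gerDl.
by rewrite -ltrBlDl; near: h; apply: nbhs_left_gt; rewrite subr_lt0.
Unshelve. all: by end_near. Qed.

Lemma right_derivativeN u a d :
  right_derivative u a d -> right_derivative (\- u) a (- d).
Proof.
move=> ud; apply: cvg_trans (cvgN ud); apply: near_eq_cvg; apply: nearW => h.
by rewrite /= !opprfctE/=; ring.
Qed.

Lemma right_derivative_gt0 u a d : u a = 0 -> 0 < d -> right_derivative u a d ->
  exists2 e, 0 < e & forall x, a < x < a + e -> 0 < u x.
Proof.
move=> ua d0 /cvgrPdist_lt/(_ _ d0)[e /= e0 H]; exists e => // x /andP[ax xe].
have xa0 : 0 < x - a by rewrite subr_gt0.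
have := H (x - a); rewrite /= sub0r normrN gtr0_norm// ltrBlDl => /(_ xe xa0).
rewrite (addrC a) subrK ua subr0 => /ltr_normlP[_].
by rewrite ltrBlDr ltrDl pmulr_rgt0// invr_gt0.
Qed.

Lemma continuous_vanish_closed (f : R -> R) a b : a < b -> {within `[a, b], continuous f} ->
  {in `]a, b[, forall x, f x = 0} -> {in `[a, b], forall x, f x = 0 :> R}.
Proof.
move=> ab /(continuous_within_itvP _ ab)[_ fa fb] f0 x.
rewrite in_itv/= => /andP[]; rewrite le_eqVlt => /predU1P[<- _|ax].
  apply: (norm_cvg_unique fa) => //; apply: cvg_near_cst; near=> y.
  by apply/f0; rewrite in_itv/=; apply/andP; split => //; near: y; exact: nbhs_right_lt.
rewrite le_eqVlt => /predU1P[->|xb]; last by apply: f0; rewrite in_itv/= ax.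
apply: (norm_cvg_unique fb) => //; apply: cvg_near_cst; near=> y.
by apply/f0; rewrite in_itv/=; apply/andP; split => //; near: y; exact: nbhs_left_gt.
Unshelve. all: by end_near. Qed.

Lemma derive0_constant (f : R -> R) a b : {in `]a, b[, forall x : R, is_derive x 1 f 0} ->
  {in `]a, b[ &, forall x y, f x = f y :> R}.
Proof.
move=> f0 x y; wlog xy : x y / x <= y => [W xab yab|].
  by case/orP: (le_total x y) => xy; [|apply: esym]; exact: W.
move=> xab yab.
have sub z : z \in `[x, y] -> z \in `]a, b[.
  move: xab yab; rewrite !in_itv/= => /andP[ax _] /andP[_ yb] /andP[xz zy].
  by rewrite (lt_le_trans ax xz) (le_lt_trans zy yb).
have := @MVT_segment R f (fun=> 0) x y xy.
case=> [z zxy||c _ /eqP].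
- by apply/f0/sub; apply: subset_itv_oo_cc.
- by apply: derivable_within_continuous => z /sub/f0 [].
- by rewrite mul0r subr_eq0 => /eqP.
Qed.

End one_sided_derivative.

(** * Solving the equation bump by bump *)

Section fucik_bumps.
Context {R : realType}.
Implicit Types (u w : R -> R) (a b c d om al be : R).

(** The coefficients of [w] in the rotating frame of cosine and sine are constant, and [w] is
    recovered from them by cos^2 + sin^2 = 1. *)
Lemma harmonic_solution w om a b : 0 < om -> a < b ->
  {within `[a, b], continuous w} ->
  {in `]a, b[, forall x, [/\ derivable w x 1, derivable (derive1 w) x 1 &
     derive1 (derive1 w) x = - om ^+ 2 * w x]} ->
  exists P Q, {in `[a, b], forall x,
    w x = P * cos (om * (x - a)) + Q * sin (om * (x - a))}.
Proof.
move=> om0 ab wc wd; have omn0 := lt0r_neq0 om0.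
(* p and q are first integrals of w'' = - om ^ 2 w. *)
pose p x := w x * cos (om * (x - a)) - om^-1 * (derive1 w x * sin (om * (x - a))).
pose q x := w x * sin (om * (x - a)) + om^-1 * (derive1 w x * cos (om * (x - a))).
(* Any interior point would do as reference: the derivative of [w] is not controlled at the end
   points. *)
pose m := (a + b) / 2.
have mab : m \in `]a, b[ by rewrite in_itv/= /m !midf_lt.
have dw x : x \in `]a, b[ -> is_derive x 1 w (derive1 w x).
  by move=> /wd[/derivableP + _ _]; rewrite derive1E.
have dw1 x : x \in `]a, b[ -> is_derive x 1 (derive1 w) (- om ^+ 2 * w x).
  by move=> /wd[_ /derivableP + <-]; rewrite -derive1E.
have pE : {in `]a, b[, forall x, p x = p m}.
  move=> x xab; apply: (derive0_constant p a b) => // y yab.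
  have := dw _ yab; have := dw1 _ yab => ? ?.
  by apply: is_derive_eq; rewrite /GRing.scale/=; field.
have qE : {in `]a, b[, forall x, q x = q m}.
  move=> x xab; apply: (derive0_constant q a b) => // y yab.
  have := dw _ yab; have := dw1 _ yab => ? ?.
  by apply: is_derive_eq; rewrite /GRing.scale/=; field.
exists (p m), (q m) => x xab; apply/eqP; rewrite -subr_eq0; apply/eqP.
pose g x := p m * cos (om * (x - a)) + q m * sin (om * (x - a)).
apply: (continuous_vanish_closed (w - g) a b) xab => //.
  move=> y; apply: cvgB; first exact: wc.
  apply: continuous_subspaceT => {}y.
  apply/differentiable_continuous/derivable1_diffP.
  by apply: ex_derive.
move=> y yab; rewrite /g !fctE -(pE y yab) -(qE y yab) /p /q.
have := cos2Dsin2 (om * (y - a)) => h.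
set C := cos _ in h *; set S := sin _ in h *.
transitivity (w y * (1 - (C ^+ 2 + S ^+ 2))); first by ring.
by rewrite h subrr mulr0.
Qed.

(** An arbitrary interval and no boundary values, so that a solution can be restricted to what
    follows a bump and be reflected. *)
Definition fucik_ode al be u a b :=
  [/\ {within `[a, b], continuous u},
      {in `]a, b[, forall x, derivable u x 1 /\ derivable (derive1 u) x 1} &
      {in `]a, b[, forall x,
        - derive1 (derive1 u) x = al * u^\+ x - be * u^\- x}].

Lemma fucik_odeS al be u a b c d : a <= c -> d <= b ->
  fucik_ode al be u a b -> fucik_ode al be u c d.
Proof.
move=> ac db [uc ud uE].
have s : `]c, d[ `<=` `]a, b[ by apply: subset_itv; rewrite bnd_simp.
split.
- by apply: continuous_subspaceW uc; apply: subset_itv; rewrite bnd_simp.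
- by move=> x /s/ud.
- by move=> x /s/uE.
Qed.

Lemma derive1N u x : derivable u x 1 -> derive1 (\- u) x = - derive1 u x.
Proof. by move=> ux; rewrite !derive1E (deriveN _) . Qed.

(** Positive and negative parts exchange roles under negation; negative bumps are thereby treated as
    positive ones. *)
Lemma fucik_odeN al be u a b : fucik_ode al be u a b -> fucik_ode be al (\- u) a b.
Proof.
move=> [uc ud uE].
have dN x : x \in `]a, b[ -> \forall y \near x, derive1 (\- u) y = - derive1 u y.
  move=> xab; near=> y; rewrite derive1N//.
  have /ud[//] : y \in `]a, b[ by near: y; exact: near_in_itvoo.
split.
- by move=> x; apply: cvgN; exact: uc.
- move=> x xab; have [ux u1x] := ud _ xab; split; first exact: derivableN.
  have : derivable (\- derive1 u) x 1 by exact: derivableN.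
  apply: near_eq_derivable.
  by have := dN _ xab; apply: filterS => y ->.
- move=> x xab; have [ux u1x] := ud _ xab.
  rewrite derive1E (near_eq_derive (g := \- derive1 u)); last exact: dN.
  rewrite (deriveN _)// -derive1E.
  have -> : - - derive1 (derive1 u) x = - (al * u^\+ x - be * u^\- x).
    by rewrite -uE.
  rewrite /funrpos /funrneg/= opprK; ring.
Unshelve. all: by end_near. Qed.

(** Where [u] is nonnegative the equation is linear; [u a = 0] removes the cosine and the slope [d]
    fixes the sine. *)
Lemma fucik_positive_harmonic al be u a c d : 0 < al -> a < c ->
  fucik_ode al be u a c -> u a = 0 -> right_derivative u a d ->
  {in `]a, c[, forall x, 0 <= u x} ->
  {in `[a, c], forall x, u x = d / Num.sqrt al * sin (Num.sqrt al * (x - a))}.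
Proof.
move=> al0 ac [uc ud uE] ua uda u0.
set om := Num.sqrt al; have om0 : 0 < om by rewrite sqrtr_gt0.
have om2 : om ^+ 2 = al by rewrite sqr_sqrtr// ltW.
have [|P [Q uPQ]] := harmonic_solution u om a c om0 ac uc.
  move=> x xac; have [ux u1x] := ud _ xac; split => //.
  have := uE _ xac; have := u0 _ xac; rewrite /funrpos /funrneg/= om2 => ux0.
  rewrite (max_idPl ux0) (max_idPr _) ?oppr_le0// mulr0 subr0 => E.
  by rewrite mulNr -E opprK.
have P0 : P = 0.
  have := uPQ a; rewrite in_itv/= lexx (ltW ac) subrr mulr0 sin0 cos0 mulr1 mulr0 addr0 ua.
  by move=> ->.
have dQ : d = Q * om.
  apply: (right_derivative_unique u (fun x => Q * sin (om * (x - a))) a c) => //.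
    move=> x xac; rewrite uPQ ?P0 ?mul0r ?add0r//.
    by apply: subset_itv xac; rewrite bnd_simp.
  by apply: is_derive_eq; rewrite /GRing.scale/= subrr mulr0 cos0; ring.
by move=> x xac; rewrite uPQ// P0 mul0r add0r dQ mulfK// gt_eqF.
Qed.

Section bump.
Variables (al be : R) (u : R -> R) (a b d : R).
Hypotheses (al0 : 0 < al) (d0 : 0 < d).
Let l := pi / Num.sqrt al.
Hypotheses (lb : a + l <= b) (ode : fucik_ode al be u a b).
Hypotheses (ua : u a = 0) (uda : right_derivative u a d).

Let om0 : 0 < Num.sqrt al. Proof. by rewrite sqrtr_gt0. Qed.
Let l0 : 0 < l. Proof. by rewrite divr_gt0// pi_gt0. Qed.
Let al_lt : a < a + l. Proof. by rewrite ltrDl. Qed.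
Let oml : Num.sqrt al * l = pi. Proof. by rewrite mulrC divfK ?gt_eqF. Qed.

(* Before its first zero c, u solves the linear equation, hence is a multiple of
   sin (sqrt al (x - a)), which does not vanish at c < a + l. *)
Lemma fucik_bump_gt0 : {in `]a, a + l[, forall x, 0 < u x}.
Proof.
move=> z zal; rewrite ltNge; apply/negP => uz.
pose Z := [set x | a < x < a + l /\ u x <= 0].
have Zz : Z z by split => //; rewrite (itvP zal).
have [e e0 upos] := right_derivative_gt0 u a d ua d0 uda.
have lbZ : lbound Z (a + e).
  move=> x [/andP[ax _] ux]; rewrite leNgt; apply/negP => xe.
  have := upos x; rewrite xe ax => /(_ isT).
  by rewrite ltNge ux.
have Zinf : has_inf Z by split; [exists z|exists (a + e)].
set c := inf Z.
have aec : a + e <= c by apply: lb_le_inf => //; exists z.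
have ac : a < c by rewrite (lt_le_trans _ aec)// ltrDl.
have cz : c <= z by apply: ge_inf => //; exact: Zinf.2.
have cl : c < a + l by rewrite (le_lt_trans cz)// (itvP zal).
have upos' : {in `]a, c[, forall x, 0 <= u x}.
  move=> x xac; rewrite leNgt; apply/negP => ux.
  have : c <= x.
    apply: ge_inf; first exact: Zinf.2.
    split; last exact: ltW.
    by rewrite (itvP xac) (lt_trans _ cl)// (itvP xac).
  by rewrite leNgt (itvP xac).
have odec : fucik_ode al be u a c.
  by apply: fucik_odeS ode => //; rewrite (le_trans _ lb)// ltW.
have uc : 0 < u c.
  have -> := fucik_positive_harmonic al be u a c d al0 ac odec ua uda upos'.
    rewrite mulr_gt0// ?divr_gt0// sin_gt0_pi// mulr_gt0 ?subr_gt0//=.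
    by rewrite -ltr_pdivlMl// mulrC ltrBlDl.
  by rewrite in_itv/= lexx ltW.
have ab : a < b by rewrite (lt_le_trans al_lt).
have ucc : {for c, continuous u}.
  case: ode => ucont _ _; apply: (within_continuous_continuous ab ucont).
  by rewrite in_itv/= ac (lt_le_trans cl).
(* By continuity [u] is positive around [c], yet the infimum [c] is approached by points of [Z]. *)
have [e' /= e'0 ue'] : \forall x \near c, 0 < u x by exact: (cvgr_gt _ ucc).
have [x [xal ux] xc] := inf_adherent e'0 Zinf.
have cx : c <= x by apply: ge_inf; [exact: Zinf.2|split].
have := ue' x; rewrite /= distrC ger0_norm ?subr_ge0// ltrBlDl => /(_ xc).
by rewrite ltNge ux.
Qed.

Lemma fucik_bump : {in `[a, a + l], forall x,
  u x = d / Num.sqrt al * sin (Num.sqrt al * (x - a))}.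
Proof.
apply: (fucik_positive_harmonic al be) => //; first exact: fucik_odeS ode.
by move=> x /fucik_bump_gt0/ltW.
Qed.

Lemma fucik_bump_end : u (a + l) = 0.
Proof.
rewrite fucik_bump ?in_itv/= ?lexx ?(ltW al_lt)//.
by rewrite (addrC a) addrK oml sinpi mulr0.
Qed.

(** Being differentiable there, [u] leaves the zero with the slope at which it arrives, and d cos pi
    = - d. Hence [\- u] starts its next bump with slope [d] again. *)
Lemma fucik_bump_right_derivative : a + l < b -> right_derivative u (a + l) (- d).
Proof.
move=> alb; apply: is_derive_right.
have [_ + _] := ode => /(_ (a + l)); rewrite in_itv/= al_lt alb => /(_ isT)[/derivableP du _].
apply: (@is_derive_eq _ _ _ _ _ _ _ _ du).
pose g x := d / Num.sqrt al * sin (Num.sqrt al * (x - a)).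
apply: (left_derivative_unique u g a (a + l) _ _ al_lt) => [x xal|].
  by apply/fucik_bump; apply: subset_itv xal; rewrite bnd_simp.
apply: is_derive_eq; rewrite /GRing.scale/= (addrC a) addrK oml cospi.
by field; rewrite gt_eqF.
Qed.

End bump.

Section periods.
Variables (al be : R) (u : R -> R) (b d : R).
Hypotheses (al0 : 0 < al) (be0 : 0 < be) (d0 : 0 < d).
Hypotheses (ode : fucik_ode al be u 0 b).
Hypotheses (u0 : u 0 = 0) (ud0 : right_derivative u 0 d).
Let l1 := pi / Num.sqrt al.
Let l2 := pi / Num.sqrt be.
Let l := l1 + l2.

(** One period, parametrised by the initial slope [d]: both bumps start with slope [d] in absolute
    value, which gives the amplitudes. Normalization comes later and amounts to a choice of [d]. *)
Definition fucik_profile y :=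
  if y <= l1 then d / Num.sqrt al * sin (Num.sqrt al * y)
  else - (d / Num.sqrt be * sin (Num.sqrt be * (y - l1))).

Let l1_gt0 : 0 < l1. Proof. by rewrite divr_gt0 ?pi_gt0 ?sqrtr_gt0. Qed.
Let l2_gt0 : 0 < l2. Proof. by rewrite divr_gt0 ?pi_gt0 ?sqrtr_gt0. Qed.

Let one_period a : 0 <= a -> a + l <= b -> u a = 0 -> right_derivative u a d ->
  [/\ {in `[0, l], forall y, u (a + y) = fucik_profile y},
      u (a + l) = 0 & a + l < b -> right_derivative u (a + l) d].
Proof.
move=> a0 alb ua uda.
have al1b : a + l1 < b by rewrite (lt_le_trans _ alb)// ltrD2l /l ltrDl.
have odea : fucik_ode al be u a b by exact: fucik_odeS ode.
have H1 := fucik_bump al be u a b d al0 d0 (ltW al1b) odea ua uda.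
have E1 := fucik_bump_end al be u a b d al0 d0 (ltW al1b) odea ua uda.
have D1 := fucik_bump_right_derivative al be u a b d al0 d0 (ltW al1b) odea ua uda al1b.
have alE : a + l1 + l2 = a + l by rewrite -addrA.
(* The second half of the period is a positive bump of [\- u] with the parameters exchanged. *)
have ode1 : fucik_ode be al (\- u) (a + l1) b.
  by apply: fucik_odeN; apply: fucik_odeS odea; rewrite // lerDl ltW.
have uN1 : (\- u) (a + l1) = 0 by rewrite /= E1 oppr0.
have D1N : right_derivative (\- u) (a + l1) d.
  by rewrite -[d]opprK; exact: right_derivativeN.
rewrite -alE in alb *.
have H2 := fucik_bump be al (\- u) (a + l1) b d be0 d0 alb ode1 uN1 D1N.
have E2 := fucik_bump_end be al (\- u) (a + l1) b d be0 d0 alb ode1 uN1 D1N.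
have D2 := fucik_bump_right_derivative be al (\- u) (a + l1) b d be0 d0 alb ode1 uN1 D1N.
split.
- move=> y yl; rewrite /fucik_profile; case: ifPn => [yl1|].
    rewrite H1; first by rewrite (addrC a) addrK.
    by rewrite in_itv/= lerDl lerD2l yl1 (itvP yl).
  rewrite -ltNge => yl1; have := H2 (a + y).
  rewrite in_itv/= lerD2l (ltW yl1) alE lerD2l (itvP yl) => /(_ isT) h.
  by rewrite -[LHS]opprK [- u _]h opprD addrACA subrr add0r.
- by apply/eqP; rewrite -oppr_eq0; apply/eqP.
- move=> /D2/right_derivativeN; rewrite opprK.
  by rewrite (_ : \- (\- u) = u)//; apply/funext => x /=; rewrite opprK.
Qed.

Lemma fucik_periods i : i.+1%:R * l <= b ->
  {in `[0, l], forall y, u (i%:R * l + y) = fucik_profile y}.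
Proof.
have l0 : 0 < l by rewrite addr_gt0.
have iE j : j.+1%:R * l = j%:R * l + l by rewrite -natr1 mulrDl mul1r.
have H j : j%:R * l < b -> u (j%:R * l) = 0 /\ right_derivative u (j%:R * l) d.
  elim: j => [|j ih]; first by rewrite mul0r.
  rewrite iE => jb.
  have [|uj dj] := ih; first by rewrite (lt_trans _ jb)// ltrDl.
  have j0 : 0 <= j%:R * l by rewrite mulr_ge0// ltW.
  by have [_ ? /(_ jb)] := one_period (j%:R * l) j0 (ltW jb) uj dj.
rewrite iE => ib; have [|ui di] := H i.
  by rewrite (lt_le_trans _ ib)// ltrDl.
have i0 : 0 <= i%:R * l by rewrite mulr_ge0// ltW.
by have [] := one_period (i%:R * l) i0 ib ui di.
Qed.

End periods.

End fucik_bumps.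


(** * Integrals of Fucik eigenfunctions against sines *)

Section segment_integral.
Context {R : realType}.
Local Notation mu := (@lebesgue_measure R).
Implicit Types (f g G : R -> R) (a b c l : R).

Lemma segment_integrable g a b : {within `[a, b], continuous g} ->
  mu.-integrable `[a, b] (EFin \o g).
Proof.
by move=> cg; apply: continuous_compact_integrable => //; exact: segment_compact.
Qed.

Lemma Rintegral_segment_split g a b c : a <= b <= c ->
  {within `[a, c], continuous g} ->
  \int[mu]_(x in `[a, c]) g x =
  \int[mu]_(x in `[a, b]) g x + \int[mu]_(x in `[b, c]) g x.
Proof.
move=> /andP[ab bc] cg; have ig := segment_integrable g a c cg.
apply/eqP; rewrite addrC -subr_eq; apply/eqP.
rewrite Rintegral_itvB ?bnd_simp// Rintegral_itv_obnd_cbnd//.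
by apply: integrableS ig => //; apply: subset_itv; rewrite bnd_simp.
Qed.

Lemma Rintegral_FTC2 g G a b : a <= b -> continuous g ->
  (forall x : R, is_derive x 1 G (g x)) -> \int[mu]_(x in `[a, b]) g x = G b - G a.
Proof.
rewrite le_eqVlt => /predU1P[<- _ _|ab cg dG].
  by rewrite set_itv1 Rintegral_set1 subrr.
have cG : continuous G.
  by move=> x; apply/differentiable_continuous/derivable1_diffP; have [] := dG x.
rewrite /Rintegral (continuous_FTC2 ab (F := G))//=.
- exact: continuous_subspaceT.
- split => [x _||]; first by have [] := dG x.
  + by apply: cvg_at_right_filter; exact: cG.
  + by apply: cvg_at_left_filter; exact: cG.
- by move=> x _; rewrite derive1E; have [] := dG x.
Qed.

Lemma Rintegral_shift g c l : 0 <= l -> {within `[c, c + l], continuous g} ->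
  \int[mu]_(x in `[c, c + l]) g x = \int[mu]_(y in `[0, l]) g (c + y).
Proof.
move=> l0 cg.
have d1 : derive1 (fun y : R => c + y) = cst 1.
  by apply/funext => y; rewrite derive1E derive_val add0r mulr1.
rewrite /Rintegral (_ : `[c, c + l]%classic =
  `[(fun y : R => c + y) 0, (fun y : R => c + y) l]%classic); last by rewrite addr0.
rewrite (@integration_by_substitution_increasing _ (fun y : R => c + y) g 0 l)//.
- by congr fine; apply: eq_integral => y _ /=; rewrite !fctE d1 mulr1.
- by move=> x y _ _ xy; rewrite ltrD2l.
- by move=> y _; rewrite d1; exact: cvg_cst.
- by rewrite d1; exact: is_cvg_cst.
- by rewrite d1; exact: is_cvg_cst.
- have cF : continuous (fun y : R => c + y).
    by move=> x; apply: cvgD; [exact: cvg_cst|exact: cvg_id].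
  split => [x _||]; first by apply: ex_derive.
  + by apply: cvg_at_right_filter; exact: cF.
  + by apply: cvg_at_left_filter; exact: cF.
- by rewrite addr0.
Qed.

Lemma Rintegral_periods g l k : 0 <= l ->
  {within `[0, k%:R * l], continuous g} ->
  \int[mu]_(x in `[0, k%:R * l]) g x =
  \sum_(i < k) \int[mu]_(y in `[0, l]) g (i%:R * l + y).
Proof.
move=> l0; elim: k => [|k ih] cg.
  by rewrite mul0r set_itv1 Rintegral_set1 big_ord0.
have kl : 0 <= k%:R * l by rewrite mulr_ge0.
have kE : k.+1%:R * l = k%:R * l + l by rewrite -natr1 mulrDl mul1r.
rewrite kE in cg *.
rewrite (Rintegral_segment_split _ _ (k%:R * l)) ?kl ?lerDl// big_ord_recr/=.
congr (_ + _).
  by apply: ih; apply: continuous_subspaceW cg; apply: subset_itv; rewrite bnd_simp// lerDl.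
apply: Rintegral_shift => //.
by apply: continuous_subspaceW cg; apply: subset_itv; rewrite bnd_simp.
Qed.

Lemma continuous_sin_affine p q : continuous (fun y : R => sin (p * y + q)).
Proof.
by move=> y; apply/differentiable_continuous/derivable1_diffP; apply: ex_derive.
Qed.

Lemma continuous_sin_lin p : continuous (fun y : R => sin (p * y)).
Proof.
by move=> y; apply/differentiable_continuous/derivable1_diffP; apply: ex_derive.
Qed.

Lemma sin_lipschitz (x y : R) : `|sin x - sin y| <= `|x - y|.
Proof.
wlog xy : x y / y <= x => [W|].
  by case/orP: (le_total y x) => xy; [|rewrite distrC (distrC x)]; exact: W.
have [|c _ ->] := @MVT_segment R sin cos y x xy.
- by apply: continuous_subspaceT; exact: continuous_sin.
- by rewrite normrM ler_piMl// cos_max.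
Qed.

End segment_integral.

(** * Sums of sines in arithmetic progression *)

Section trigonometric_sums.
Context {R : realType}.

(** Telescoping: 2 sin (t / 2) sin y = cos (y - t / 2) - cos (y + t / 2). *)
Lemma sum_sin_progression (t p : R) k :
  2 * sin (t / 2) * \sum_(i < k) sin (i%:R * t + p) =
  cos (p - t / 2) - cos (k%:R * t + p - t / 2).
Proof.
elim: k => [|k ih]; first by rewrite big_ord0 mul0r add0r subrr mulr0.
rewrite big_ord_recr/= mulrDr ih -addrA; congr (_ + _).
have -> : k.+1%:R * t + p - t / 2 = (k%:R * t + p) + t / 2 by rewrite -natr1; field.
by rewrite (cosB (k%:R * t + p)) (cosD (k%:R * t + p)); ring.
Qed.

(** The total phase is [j] full turns, so the telescoped sum vanishes, while [0 < j < k] keeps sin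
    (t / 2) away from 0. *)
Lemma sum_sin_period (k j : nat) (p : R) : (0 < j < k)%N ->
  \sum_(i < k) sin (i%:R * (j%:R * (pi *+ 2) / k%:R) + p) = 0.
Proof.
move=> /andP[j0 jk]; have k0 : (0 < k)%N by exact: leq_trans jk.
set t := _ / k%:R.
have kn0 : k%:R != 0 :> R by rewrite pnatr_eq0 -lt0n.
have s0 : 0 < sin (t / 2).
  have -> : t / 2 = j%:R / k%:R * pi by rewrite /t -mulr_natr; field.
  apply: sin_gt0_pi; rewrite mulr_gt0 ?divr_gt0 ?ltr0n ?pi_gt0//=.
  by rewrite gtr_pMl ?pi_gt0// ltr_pdivrMr ?ltr0n// mul1r ltr_nat.
have := sum_sin_progression t p k.
have -> : k%:R * t + p - t / 2 = (p - t / 2) + pi *+ 2 *+ j.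
  by rewrite /t -[in RHS]mulr_natl; field.
rewrite (periodicn (@cosD2pi R)) subrr => /eqP; rewrite mulf_eq0 => /orP[|/eqP//].
by rewrite mulf_eq0 pnatr_eq0/= gt_eqF.
Qed.

End trigonometric_sums.

(** * Integrals of a sine bump against a sine *)

Section bump_integrals.
Context {R : realType}.
Local Notation mu := (@lebesgue_measure R).
Implicit Types w m c : R.

Lemma continuous_sin_product (w m c : R) :
  continuous (fun y : R => sin (w * y) * sin (m * y + c)).
Proof.
by move=> y; apply: cvgM; [exact: continuous_sin_lin|exact: continuous_sin_affine].
Qed.

Lemma Rintegral_sin_product w m c t : 0 <= t -> m ^+ 2 != w ^+ 2 ->
  \int[mu]_(y in `[0, t]) (sin (w * y) * sin (m * y + c)) =
  (w * (cos (w * t) * sin (m * t + c)) - m * (sin (w * t) * cos (m * t + c))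
   - w * sin c) / (m ^+ 2 - w ^+ 2).
Proof.
move=> t0 mw; have mw0 : m ^+ 2 - w ^+ 2 != 0 by rewrite subr_eq0.
(* For f'' = - w^2 f and g'' = - m^2 g, the Wronskian f' g - f g' has derivative (m^2 - w^2) f g. *)
pose G y := (m ^+ 2 - w ^+ 2)^-1 *
  (w * (cos (w * y) * sin (m * y + c)) - m * (sin (w * y) * cos (m * y + c))).
have dG (y : R) : is_derive y 1 G (sin (w * y) * sin (m * y + c)).
  by apply: is_derive_eq; rewrite /GRing.scale/=; field.
rewrite (Rintegral_FTC2 _ _ _ _ t0 (continuous_sin_product w m c) dG).
by rewrite /G !mulr0 add0r cos0 sin0; field.
Qed.

Lemma Rintegral_sin_sqr w t : 0 < w -> 0 <= t ->
  \int[mu]_(y in `[0, t]) (sin (w * y) * sin (w * y)) =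
  (t - w^-1 * (sin (w * t) * cos (w * t))) / 2.
Proof.
move=> w0 t0; have wn0 := lt0r_neq0 w0.
pose G y := 2^-1 * (y - w^-1 * (sin (w * y) * cos (w * y))).
have dG (y : R) : is_derive y 1 G (sin (w * y) * sin (w * y)).
  apply: is_derive_eq; rewrite /GRing.scale/=.
  have := cos2Dsin2 (w * y); set C := cos _; set S := sin _ => h.
  transitivity (2^-1 * (1 - (C ^+ 2 + S ^+ 2)) + S * S); first by field.
  by rewrite h subrr mulr0 add0r.
rewrite (Rintegral_FTC2 _ G _ _ t0 _ dG).
  by rewrite /G mulr0 sin0; field.
by move=> y; apply: cvgM; exact: continuous_sin_lin.
Qed.

Lemma Rintegral_bump w m c : 0 < w -> m ^+ 2 != w ^+ 2 ->
  \int[mu]_(y in `[0, pi / w]) (sin (w * y) * sin (m * y + c)) =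
  w * (sin (m * (pi / w) + c) + sin c) / (w ^+ 2 - m ^+ 2).
Proof.
move=> w0 mw; have mw0 : m ^+ 2 - w ^+ 2 != 0 by rewrite subr_eq0.
have wm0 : w ^+ 2 - m ^+ 2 != 0 by rewrite subr_eq0 eq_sym.
rewrite Rintegral_sin_product//; last by rewrite divr_ge0 ?pi_ge0// ltW.
rewrite (mulrC w (pi / w)) divfK ?gt_eqF// cospi sinpi; field.
by rewrite wm0 mw0.
Qed.

Lemma Rintegral_bump_sqr_gt0 w : 0 < w ->
  0 < \int[mu]_(y in `[0, pi / w]) (sin (w * y) * sin (w * y)).
Proof.
move=> w0; rewrite Rintegral_sin_sqr//; last by rewrite divr_ge0 ?pi_ge0// ltW.
rewrite (mulrC w (pi / w)) divfK ?gt_eqF// sinpi mul0r mulr0 subr0.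
by rewrite !divr_gt0 ?pi_gt0.
Qed.

(** The sine and the gap change sign together: m pi / w crosses pi exactly when [m] crosses [w], and
    stays below 2 pi. *)
Lemma sin_over_gap_gt0 w m : 0 < w -> 0 < m < 2 * w -> m ^+ 2 != w ^+ 2 ->
  0 < w * sin (m * (pi / w)) / (w ^+ 2 - m ^+ 2).
Proof.
move=> w0 /andP[m0 m2] mw.
have [lmw|lwm|E] := ltgtP m w; last by move: mw; rewrite E eqxx.
- rewrite divr_gt0// ?subr_gt0 ?ltr_pXn2r ?nnegrE ?ltW// mulr_gt0// sin_gt0_pi//.
  rewrite mulr_gt0 ?divr_gt0 ?pi_gt0//=.
  by rewrite mulrA ltr_pdivrMr// mulrC ltr_pM2l ?pi_gt0.
- rewrite -[X in 0 < X]mulrNN -invrN opprB divr_gt0// ?subr_gt0 ?ltr_pXn2r ?nnegrE ?ltW//.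
  rewrite -mulrN mulr_gt0//.
  have -> : m * (pi / w) = (m - w) * (pi / w) + pi by field; rewrite gt_eqF.
  rewrite sinDpi opprK sin_gt0_pi//.
  rewrite mulr_gt0 ?subr_gt0 ?divr_gt0 ?pi_gt0//=.
  rewrite mulrA ltr_pdivrMr// mulrC ltr_pM2l ?pi_gt0//.
  lra.
Qed.

(** The closed formula has a vanishing denominator at [m = w], where the integrand is a square. *)
Lemma bump_integral_gt0 w m : 0 < w -> 0 < m < 2 * w ->
  0 < \int[mu]_(y in `[0, pi / w]) (sin (w * y) * sin (m * y)).
Proof.
move=> w0 mw; have [E|mw2] := eqVneq (m ^+ 2) (w ^+ 2).
  have -> : m = w.
    by move/eqP: E; rewrite eqrXn2// ?ltW// => [/eqP//|]; case/andP: mw.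
  exact: Rintegral_bump_sqr_gt0.
under eq_Rintegral do rewrite -[X in sin (m * X)]addr0 mulrDr mulr0.
rewrite Rintegral_bump// addr0 sin0 addr0.
exact: sin_over_gap_gt0.
Qed.

(** With frequency [- m] and phase m pi / w, the two boundary terms of the closed formula trade
    places, so no change of variables is required. *)
Lemma reflected_bump_integral_gt0 w m : 0 < w -> 0 < m < 2 * w ->
  0 < \int[mu]_(y in `[0, pi / w]) (sin (w * y) * sin (m * (pi / w) - m * y)).
Proof.
move=> w0 mw; have [E|mw2] := eqVneq (m ^+ 2) (w ^+ 2).
  have -> : m = w.
    by move/eqP: E; rewrite eqrXn2// ?ltW// => [/eqP//|]; case/andP: mw.
  under eq_Rintegral => y _.
    rewrite (mulrC w (pi / w)) divfK ?gt_eqF// sinB sinpi cospi mul0r sub0r mulN1r opprK.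
  over.
  exact: Rintegral_bump_sqr_gt0.
under eq_Rintegral do rewrite [_ - m * _]addrC -mulNr.
rewrite Rintegral_bump ?sqrrN// mulNr addNr sin0 add0r.
exact: sin_over_gap_gt0.
Qed.

Lemma sin_mulrn_pi (n : nat) : sin (n%:R * pi) = 0 :> R.
Proof.
by rewrite mulr_natl -[_ *+ n]add0r (alternatingn (@sinDpi R)) sin0 mulr0.
Qed.

Lemma sine_orthogonality (m n : nat) : (0 < m)%N -> (0 < n)%N ->
  \int[mu]_(y in `[0, pi]) (sin (m%:R * y) * sin (n%:R * y)) =
  if m == n then pi / 2 else 0.
Proof.
move=> m0 n0; have [->|mn] := eqVneq m n.
  by rewrite Rintegral_sin_sqr ?ltr0n ?pi_ge0// sin_mulrn_pi mul0r mulr0 subr0.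
under eq_Rintegral do rewrite -[n%:R * _]addr0.
rewrite Rintegral_sin_product ?pi_ge0//.
  by rewrite !addr0 !sin_mulrn_pi sin0 !mul0r !mulr0 !subr0 mul0r.
by rewrite -!natrX eqr_nat eqn_exp2r// eq_sym.
Qed.

End bump_integrals.

(** * Solutions with k periods in [0, pi] against the even sines *)

Section fucik_even.
Context {R : realType}.
Local Notation mu := (@lebesgue_measure R).
Variables (k : nat) (al be d : R) (u : R -> R).
Hypotheses (k0 : (0 < k)%N) (al0 : 0 < al) (be0 : 0 < be) (d0 : 0 < d).
Let a := Num.sqrt al.
Let b := Num.sqrt be.
Let l1 := pi / a.
Let l2 := pi / b.
Let l := l1 + l2.
Let n : R := (2 * k)%:R.
Hypothesis kl : k%:R * l = pi.
Hypothesis ucont : {within `[0, pi], continuous u}.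
Hypothesis uE : forall i, (i < k)%N ->
  {in `[0, l], forall y, u (i%:R * l + y) = fucik_profile al be d y}.

Let a0 : 0 < a. Proof. by rewrite sqrtr_gt0. Qed.
Let b0 : 0 < b. Proof. by rewrite sqrtr_gt0. Qed.
Let l1_gt0 : 0 < l1. Proof. by rewrite divr_gt0 ?pi_gt0. Qed.
Let l2_gt0 : 0 < l2. Proof. by rewrite divr_gt0 ?pi_gt0. Qed.
Let l_gt0 : 0 < l. Proof. by rewrite addr_gt0. Qed.
Let kR0 : 0 < k%:R :> R. Proof. by rewrite ltr0n. Qed.
Let n0 : 0 < n. Proof. by rewrite ltr0n muln_gt0. Qed.
Let nl : n * l = pi *+ 2.
Proof. by rewrite /n natrM -mulrA kl mulr_natl. Qed.
Let l_pi : l <= pi.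
Proof. by rewrite -kl ler_pMl// ler1n. Qed.

Let nab : n / a + n / b = 2.
Proof.
have : pi * (n / a + n / b) = pi * 2.
  by rewrite mulr_natr -nl /l /l1 /l2; ring.
by move/mulfI; apply; rewrite gt_eqF// pi_gt0.
Qed.

(** The range in which bump integrals are positive; it comes from [nab], since [n / b] is
    positive. *)
Let n_lt_2a : 0 < n < 2 * a.
Proof.
rewrite n0/= -ltr_pdivrMr// -nab ltrDl divr_gt0//.
Qed.

Let n_lt_2b : 0 < n < 2 * b.
Proof.
rewrite n0/= -ltr_pdivrMr// -nab ltrDr divr_gt0//.
Qed.

Let u_profile : {in `[0, l], forall y, u y = fucik_profile al be d y}.
Proof. by move=> y yl; rewrite -(uE 0%N k0 y yl) mul0r add0r. Qed.

Let within_l : {within `[0, l], continuous u}.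
Proof. by apply: continuous_subspaceW ucont; apply: subset_itv; rewrite bnd_simp. Qed.

Let cvgM_within (f : R -> R) (g : R -> R) (s t : R) :
  {within `[s, t], continuous f} -> continuous g ->
  {within `[s, t], continuous (fun x => f x * g x)}.
Proof.
by move=> fc gc x; apply: cvgM; [exact: fc|exact: (continuous_subspaceT gc)].
Qed.

Lemma fucik_periods_integral (j : nat) :
  \int[mu]_(x in `[0, pi]) (u x * sin (j%:R * x)) =
  \sum_(i < k) \int[mu]_(y in `[0, l]) (u y * sin (j%:R * y + i%:R * (j%:R * l))).
Proof.
rewrite -kl Rintegral_periods ?(ltW l_gt0)//; last first.
  by apply: cvgM_within; [rewrite kl|exact: continuous_sin_lin].
apply: eq_bigr => i _; apply: eq_Rintegral => y; rewrite inE => yl.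
rewrite (uE i)// (u_profile y)//; congr (_ * sin _); ring.
Qed.

(* The translates of sin (2 j x) by the k periods of u sum to 0. *)
Lemma fucik_even_orth j : (0 < j < k)%N ->
  \int[mu]_(x in `[0, pi]) (u x * sin ((2 * j)%:R * x)) = 0.
Proof.
move=> jk; rewrite fucik_periods_integral.
set m : R := (2 * j)%:R.
have ml : m * l = j%:R * (pi *+ 2) / k%:R.
  by rewrite /m -mulr_natr -kl natrM; field; rewrite gt_eqF.
have scont p q : {within `[0, l], continuous (fun y => u y * sin (p * y + q))}.
  by apply: cvgM_within => //; exact: continuous_sin_affine.
have int p q : mu.-integrable `[0, l] (EFin \o (fun y => u y * sin (p * y + q))).
  by apply: segment_integrable; exact: scont.
(* Addition formula for the phase of each period; cosines are written as sines shifted by pi / 2 so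
   that [sum_sin_period] covers both sums. *)
pose A := \int[mu]_(y in `[0, l]) (u y * sin (m * y + 0)).
pose B := \int[mu]_(y in `[0, l]) (u y * sin (m * y + pi / 2)).
have E (i : 'I_k) : \int[mu]_(y in `[0, l]) (u y * sin (m * y + i%:R * (m * l))) =
    sin (i%:R * (m * l) + 0) * B + sin (i%:R * (m * l) + pi / 2) * A.
  rewrite -!RintegralZl// -RintegralD//; last 2 first.
    - by apply: segment_integrable => x; apply: cvgM; [exact: cvg_cst|exact: scont].
    - by apply: segment_integrable => x; apply: cvgM; [exact: cvg_cst|exact: scont].
  apply: eq_Rintegral => y _; rewrite !sinDpihalf !addr0 sinD; ring.
under eq_bigr do rewrite E.
by rewrite big_split/= -!mulr_suml ml !sum_sin_period// !mul0r addr0.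
Qed.

(** Since [n * l] is a full turn, all periods contribute the same integral, and each of the two
    bumps makes a positive contribution to it. *)
Lemma fucik_even_diag :
  0 < \int[mu]_(x in `[0, pi]) (u x * sin ((2 * k)%:R * x)).
Proof.
rewrite fucik_periods_integral -/n.
pose I := \int[mu]_(y in `[0, l]) (u y * sin (n * y)).
have E (i : 'I_k) : \int[mu]_(y in `[0, l]) (u y * sin (n * y + i%:R * (n * l))) = I.
  apply: eq_Rintegral => y _; congr (_ * _).
  by rewrite nl mulr_natl (periodicn (@sinD2pi R)).
under eq_bigr do rewrite E.
rewrite sumr_const card_ord pmulrn_lgt0//.
rewrite /I (Rintegral_segment_split _ _ l1) ?(ltW l1_gt0) ?lerDl ?(ltW l2_gt0)//; last first.
  by apply: cvgM_within => //; exact: continuous_sin_lin.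
apply: addr_gt0.
  have -> : \int[mu]_(y in `[0, l1]) (u y * sin (n * y)) =
      \int[mu]_(y in `[0, l1]) (d / a * (sin (a * y) * sin (n * y))).
    apply: eq_Rintegral => y; rewrite inE/= in_itv/= => /andP[y0 yl1].
    rewrite u_profile /fucik_profile ?yl1 ?mulrA// in_itv/= y0.
    by rewrite (le_trans yl1)// lerDl ltW.
  rewrite RintegralZl//; first by rewrite mulr_gt0 ?divr_gt0// bump_integral_gt0.
  apply: segment_integrable; apply: continuous_subspaceT => y.
  by apply: cvgM; exact: continuous_sin_lin.
(* Reflecting the negative bump turns it into the positive one for b. *)
rewrite /l Rintegral_shift ?(ltW l2_gt0)//; last first.
  apply: (@continuous_subspaceW _ _ _ `[0, l]).
    by apply: subset_itv; rewrite bnd_simp// ltW.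
  by apply: cvgM_within => //; exact: continuous_sin_lin.
have -> : \int[mu]_(y in `[0, l2]) (u (l1 + y) * sin (n * (l1 + y))) =
    \int[mu]_(y in `[0, l2]) (d / b * (sin (b * y) * sin (n * l2 - n * y))).
  apply: eq_Rintegral => y; rewrite inE/= in_itv/= => /andP[y0 yl2].
  have -> : u (l1 + y) = - (d / b * sin (b * y)).
    rewrite u_profile; last by rewrite in_itv/= addr_ge0 ?(ltW l1_gt0)//= lerD2l.
    (* At [y = 0] the profile is still on its first branch; both branches vanish there. *)
    rewrite /fucik_profile -/a -/b -/l1; case: ifPn => [|_]; last first.
      by rewrite (addrC l1) addrK.
    rewrite gerDl => y0'; have -> : y = 0 by apply/eqP; rewrite eq_le y0 y0'.
    by rewrite addr0 mulr0 sin0 mulr0 oppr0 /l1 (mulrC a) divfK ?gt_eqF// sinpi mulr0.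
  have -> : n * (l1 + y) = - (n * l2 - n * y) + pi *+ 2 by rewrite -nl /l; ring.
  rewrite sinD2pi sinN; ring.
rewrite RintegralZl//; last first.
  apply: segment_integrable; apply: continuous_subspaceT => y.
  apply: cvgM; first exact: continuous_sin_lin.
  by apply/differentiable_continuous/derivable1_diffP; apply: ex_derive.
by rewrite mulr_gt0 ?divr_gt0// reflected_bump_integral_gt0.
Qed.

End fucik_even.


(** * Normalization and distance to the sines *)

Section normalized.
Context {R : realType}.
Local Notation mu := (@lebesgue_measure R).
Implicit Types (al be a b d m s t w z : R) (u : R -> R).

Lemma fucik_solution_ode al be u : fucik_solution al be u -> fucik_ode al be u 0 pi.
Proof.
move=> [uc ud uE _ _]; split=> // x xpi.
by have [] := ud _ xpi.
Qed.

Lemma normalized_initial al be u : normalized_fucik_eigenfunction al be u ->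
  u 0 = 0 /\ exists2 d, 0 < d & right_derivative u 0 d.
Proof.
move=> [[_ _ _ u0 _] [d d0 ud] _]; split=> //; exists d => //.
rewrite /right_derivative; move: ud; rewrite /right_derivative_at0.
by under eq_fun do rewrite -[X in u X - _]add0r.
Qed.

(** A prior bound [A] makes the set of values bounded, without which its [sup] would not be known to
    dominate them. *)
Lemma normalized_bound al be u A : normalized_fucik_eigenfunction al be u ->
  {in `[0, pi], forall x, `|u x| <= A} ->
  1 <= A /\ {in `[0, pi], forall x, `|u x| <= 1}.
Proof.
move=> [_ _ su] uA.
have ub : ubound [set `|u x| | x in `[0, pi]] A.
  by move=> _ [x xpi <-]; exact: uA.
split=> [|x xpi].
  rewrite -su; apply: ge_sup => //; exists `|u 0|; exists 0 => //=.
  by rewrite in_itv/= lexx pi_ge0.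
rewrite -su; apply: ub_le_sup; first by exists A.
by exists x.
Qed.

Lemma normalized_linear n u : (0 < n)%N ->
  normalized_fucik_eigenfunction (n%:R ^+ 2) (n%:R ^+ 2) u ->
  {in `[0, pi], forall x, u x = sin (n%:R * x)}.
Proof.
move=> n0 nu; have n0R : 0 < n%:R :> R by rewrite ltr0n.
have [u0 [d d0 ud]] := normalized_initial _ _ _ nu.
have [usol _ _] := nu.
have [uc udd uE] := fucik_solution_ode _ _ _ usol.
have [|P [Q uPQ]] := harmonic_solution u n%:R 0 pi n0R (pi_gt0 R) uc.
  move=> x xpi; have [? ?] := udd _ xpi; split=> //.
  rewrite mulNr -[LHS]opprK; congr (- _); rewrite uE// -mulrBr; congr (_ * _).
  rewrite /funrpos /funrneg/= /Num.max; case: (ltP (u x)); case: (ltP (- u x)); lra.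
have P0 : P = 0.
  have := uPQ 0; rewrite in_itv/= lexx (pi_ge0 R) subrr mulr0 sin0 cos0 u0.
  by rewrite mulr1 mulr0 addr0 => /(_ isT).
have {}uPQ : {in `[0, pi], forall x, u x = Q * sin (n%:R * x)}.
  by move=> x /uPQ ->; rewrite P0 mul0r add0r subr0.
have dQ : d = Q * n%:R.
  apply: (right_derivative_unique u (fun x => Q * sin (n%:R * x)) 0 pi) => //.
  - exact: pi_gt0.
  - by move=> x xpi; apply: uPQ; apply: subset_itv xpi; rewrite bnd_simp.
  - by apply: is_derive_eq; rewrite /GRing.scale/= mulr0 cos0; ring.
have Q0 : 0 < Q by move: d0; rewrite dQ pmulr_lgt0.
have [|Q1 u1] := normalized_bound _ _ _ Q nu.
  by move=> x /uPQ ->; rewrite normrM gtr0_norm// ler_piMr ?sin_max// ltW.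
(* The first peak, at pi / (2 n), attains the amplitude. *)
have Q1' : Q <= 1.
  have xpi : pi / (2 * n%:R) \in `[0, pi : R].
    rewrite in_itv/= divr_ge0 ?pi_ge0 ?mulr_ge0//= ler_pdivrMr ?mulr_gt0//.
    by rewrite ler_peMr ?pi_ge0// -natrM ler1n muln_gt0.
  have := u1 _ xpi; rewrite uPQ//.
  have -> : n%:R * (pi / (2 * n%:R)) = pi / 2 :> R by field; rewrite gt_eqF.
  by rewrite sin_pihalf mulr1 gtr0_norm.
have QE : Q = 1 by apply/eqP; rewrite eq_le Q1 Q1'.
by move=> x /uPQ ->; rewrite QE mul1r.
Qed.

Lemma period_cover (j : nat) (l x : R) : (0 < j)%N -> x \in `[0, j%:R * l] ->
  exists2 i : nat, (i < j)%N & x - i%:R * l \in `[0, l].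
Proof.
rewrite !in_itv/= => + /andP[x0].
elim: j => // j ih _ xj1; have [j0|j0] := posnP j.
  by move: xj1; rewrite j0 mul1r => xl; exists 0%N; rewrite // mul0r subr0 in_itv/= x0.
have [xj|xj] := leP x (j%:R * l).
  by have [//|//|i ij xi] := ih _ _; exists i => //; exact: ltnW.
exists j => //; rewrite in_itv/= subr_ge0 (ltW xj) lerBlDl.
by move: xj1; rewrite -natr1 mulrDl mul1r.
Qed.

Lemma normalized_periodic k al be u : (0 < k)%N ->
  fucik_curve (2 * k) (al, be) -> normalized_fucik_eigenfunction al be u ->
  let l := pi / Num.sqrt al + pi / Num.sqrt be in
  [/\ 0 < al, 0 < be, k%:R * l = pi, {within `[0, pi], continuous u} &
    forall i, (i < k)%N -> {in `[0, l], forall y, u (i%:R * l + y) =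
      fucik_profile al be (Num.min (Num.sqrt al) (Num.sqrt be)) y}].
Proof.
move=> k0 curve nu l; have [/= al0 be0 kl] := curve; rewrite oddM/= in kl.
have {}kl : k%:R * l = pi.
  by rewrite -[RHS]kl /l natrM; field; rewrite !gt_eqF ?sqrtr_gt0.
have [u0 [d d0 ud]] := normalized_initial _ _ _ nu.
have [usol _ _] := nu; have ode := fucik_solution_ode _ _ _ usol.
set a := Num.sqrt al in l kl *; set b := Num.sqrt be in l kl *.
have a0 : 0 < a by rewrite sqrtr_gt0.
have b0 : 0 < b by rewrite sqrtr_gt0.
have l1_gt0 : 0 < pi / a by rewrite divr_gt0 ?pi_gt0.
have l2_gt0 : 0 < pi / b by rewrite divr_gt0 ?pi_gt0.
have l0 : 0 < l by rewrite addr_gt0.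
have uE i : (i < k)%N -> {in `[0, l], forall y, u (i%:R * l + y) = fucik_profile al be d y}.
  move=> ik; apply: (fucik_periods al be u pi d) => //.
  rewrite -[X in X <= _]/(i.+1%:R * l) -[X in _ <= X]kl; by rewrite ler_pM2r// ler_nat.
(* The amplitudes of the bumps are [d / a] and [d / b]; their maximum must be 1. It bounds [u], and
   the midpoints of the two bumps show that neither amplitude exceeds 1. *)
suff dE : d = Num.min a b.
  by rewrite -dE; split=> //; have [] := ode.
have max_gt0 : 0 < Num.max (d / a) (d / b) by rewrite lt_max divr_gt0.
have [|A1 u1] := normalized_bound _ _ _ (Num.max (d / a) (d / b)) nu.
  move=> x; rewrite -kl => /(period_cover _ _ _ k0)[i ik xi].
  rewrite -[x](subrK (i%:R * l)) addrC uE// /fucik_profile -/a -/b; case: ifP => _.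
    by rewrite normrM gtr0_norm ?divr_gt0// le_max ler_piMr ?sin_max// ltW ?divr_gt0.
  rewrite normrN normrM gtr0_norm ?divr_gt0// le_max orbC ler_piMr ?sin_max//.
  by rewrite ltW ?divr_gt0.
have l_pi : l <= pi by rewrite -kl ler_pMl// ler1n.
have da : d / a <= 1.
  have yl : pi / a / 2 \in `[0, l].
    by rewrite in_itv/= divr_ge0 ?(ltW l1_gt0)//=; rewrite /l; lra.
  have := u1 (pi / a / 2); rewrite in_itv/= (itvP yl) (le_trans _ l_pi) ?(itvP yl)//.
  move=> /(_ isT); have := uE 0%N k0 _ yl; rewrite mul0r add0r => ->.
  rewrite /fucik_profile -/a -/b ifT; last by lra.
  have -> : a * (pi / a / 2) = pi / 2 by field; rewrite gt_eqF.
  by rewrite sin_pihalf mulr1 gtr0_norm ?divr_gt0.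
have db : d / b <= 1.
  have yl : pi / a + pi / b / 2 \in `[0, l].
    by rewrite in_itv/= /l; apply/andP; split; lra.
  have := u1 (pi / a + pi / b / 2); rewrite in_itv/= (itvP yl) (le_trans _ l_pi) ?(itvP yl)//.
  move=> /(_ isT); have := uE 0%N k0 _ yl; rewrite mul0r add0r => ->.
  rewrite /fucik_profile -/a -/b ifF; last by apply/negbTE; rewrite -ltNge; lra.
  have -> : b * (pi / a + pi / b / 2 - pi / a) = pi / 2 by field; rewrite !gt_eqF.
  by rewrite sin_pihalf mulr1 normrN gtr0_norm ?divr_gt0.
rewrite ler_pdivrMr// mul1r in da; rewrite ler_pdivrMr// mul1r in db.
apply/eqP; rewrite eq_le le_min da db/= ge_min.
by move: A1; rewrite le_max !ler_pdivlMr// !mul1r.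
Qed.

(** Amplitude error plus frequency error; the latter is |1 - m / w| w z by the Lipschitz bound, and
    w z is at most pi inside a bump. *)
Lemma bump_close w m z t : 0 < w -> 0 <= z <= pi / w ->
  `|t * sin (w * z) - sin (m * z)| <= `|t - 1| + `|1 - m / w| * pi.
Proof.
move=> w0 /andP[z0 zw].
have -> : t * sin (w * z) - sin (m * z) =
  (t - 1) * sin (w * z) + (sin (w * z) - sin (m * z)) by ring.
apply: le_trans (ler_normD _ _) _; apply: lerD.
  by rewrite normrM ler_piMr// sin_max.
apply: le_trans (sin_lipschitz _ _) _.
have -> : w * z - m * z = (1 - m / w) * (w * z) by field; rewrite gt_eqF.
rewrite normrM ler_wpM2l// ger0_norm ?mulr_ge0 ?(ltW w0)//.
by rewrite mulrC -ler_pdivlMr.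
Qed.

(** Assume b is the smaller. Everything is a function of p = m / a in (0, 1]: m / b = 2 - p, s = 1 /
    p - 1, and b / a - 1 = - 2 (1 - p) / (2 - p). The key estimate 1 - p <= s holds because the
    difference is (1 - p)^2 / p. *)
Lemma amplitude_close a b m : 0 < m -> 0 < a -> 0 < b -> m / a + m / b = 2 ->
  let s := Num.max a b / m - 1 in
  [/\ `|1 - m / a| <= s, `|1 - m / b| <= s,
      `|Num.min a b / a - 1| <= 2 * s & `|Num.min a b / b - 1| <= 2 * s].
Proof.
wlog ab : a b / b <= a => [W m0 a0 b0 E s|].
  case/orP: (le_total b a) => ab; first exact: W.
  have E' : m / b + m / a = 2 by rewrite addrC.
  have [] := W b a ab m0 b0 a0 E'.
  by rewrite maxC minC => ? ? ? ?; split.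
move=> m0 a0 b0 E s; rewrite (min_idPr ab) /s (max_idPl ab).
set p := m / a in E *.
have p0 : 0 < p by rewrite divr_gt0.
have mbE : m / b = 2 - p by rewrite -E; ring.
have pb : p <= m / b by rewrite ler_pM2l// lef_pV2 ?posrE.
have p1 : p <= 1 by move: pb; rewrite mbE; lra.
have amE : a / m = p^-1 by rewrite /p invf_div.
have baE : b / a = p / (2 - p).
  by rewrite -mbE /p; field; rewrite !gt_eqF.
have s1 : 1 - p <= p^-1 - 1.
  rewrite -subr_ge0 (_ : _ - _ = (1 - p) ^+ 2 / p); last by field; rewrite gt_eqF.
  by rewrite divr_ge0 ?sqr_ge0// ltW.
rewrite amE mbE baE divff ?gt_eqF// subrr normr0.
have -> : 1 - (2 - p) = - (1 - p) by ring.
rewrite normrN ger0_norm ?subr_ge0//; split=> //; last by lra.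
have -> : p / (2 - p) - 1 = - (2 * (1 - p) / (2 - p)).
  by field; rewrite gt_eqF//; lra.
rewrite normrN ger0_norm ?divr_ge0 ?mulr_ge0 ?subr_ge0//; last by lra.
rewrite ler_pdivrMr; last by lra.
apply: (@le_trans _ _ (2 * (p^-1 - 1))); first by rewrite ler_pM2l.
by rewrite ler_peMr//; lra.
Qed.

(** The constant 6 is 2 for the amplitude plus 4, a bound of pi, for the frequency. *)
Lemma fucik_even_close k al be u : (0 < k)%N ->
  fucik_curve (2 * k) (al, be) -> normalized_fucik_eigenfunction al be u ->
  {in `[0, pi], forall x, `|u x - sin ((2 * k)%:R * x)| <=
    6 * (Num.max (Num.sqrt al) (Num.sqrt be) / (2 * k)%:R - 1)}.
Proof.
move=> k0 curve nu; have [al0 be0 kl uc uE] := normalized_periodic k al be u k0 curve nu.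
set a := Num.sqrt al in kl uE *; set b := Num.sqrt be in kl uE *.
set d := Num.min a b in uE; set l := pi / a + pi / b in kl uE.
have a0 : 0 < a by rewrite sqrtr_gt0.
have b0 : 0 < b by rewrite sqrtr_gt0.
set n : R := (2 * k)%:R; have n0 : 0 < n by rewrite ltr0n muln_gt0.
have nl : n * l = pi *+ 2 by rewrite /n natrM -mulrA kl mulr_natl.
have nab : n / a + n / b = 2.
  have : pi * (n / a + n / b) = pi * 2 by rewrite mulr_natr -nl /l; ring.
  by move/mulfI; apply; rewrite gt_eqF// pi_gt0.
have [ha hb hda hdb] := amplitude_close a b n n0 a0 b0 nab.
set s := Num.max a b / n - 1 in ha hb hda hdb *; rewrite -/d in hda hdb.
have close w z : 0 < w -> `|1 - n / w| <= s -> `|d / w - 1| <= 2 * s ->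
    0 <= z <= pi / w -> `|d / w * sin (w * z) - sin (n * z)| <= 6 * s.
  move=> w0 h1 h2 zw; apply: le_trans (bump_close w n z (d / w) w0 zw) _.
  have s0 : 0 <= s by apply: le_trans h1.
  have pi4 : pi <= 4 :> R by have := @pihalf_lt2 R; lra.
  have : `|1 - n / w| * pi <= s * 4 by rewrite ler_pM// pi_ge0.
  by move: h2; lra.
have period y : y \in `[0, l] -> `|fucik_profile al be d y - sin (n * y)| <= 6 * s.
  rewrite in_itv/= => /andP[y0 yl]; rewrite /fucik_profile -/a -/b; case: ifPn => ya.
    by apply: close => //; rewrite y0.
  rewrite -ltNge in ya.
  (* The negative bump is measured backwards from the end of the period, where both functions
     vanish; it then looks like a positive one. *)
  have -> : n * y = - (n * (l - y)) + pi *+ 2 by rewrite -nl; ring.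
  rewrite sinD2pi sinN opprK -normrN opprD opprK.
  have -> : sin (b * (y - pi / a)) = sin (b * (l - y)).
    have -> : b * (y - pi / a) = - (b * (l - y)) + pi.
      by rewrite /l; field; rewrite !gt_eqF.
    by rewrite sinDpi sinN opprK.
  by apply: close => //; rewrite subr_ge0 yl/= /l; lra.
move=> x; rewrite -kl => /(period_cover _ _ _ k0)[i ik xi].
rewrite -[x](subrK (i%:R * l)); set y := x - i%:R * l in xi *.
rewrite (addrC y) uE// mulrDr (addrC _ (n * y)) (mulrCA n) nl.
rewrite (mulr_natl (pi *+ 2) i) (periodicn (@sinD2pi R)).
exact: period.
Qed.


End normalized.

(** * Density of the sines in L2(0, pi) *)

Section bernstein.
Context {R : realType}.
Implicit Types (x t : R) (q : R -> R) (n k : nat).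

Definition bernstein n k t : R := (t ^+ k * (1 - t) ^+ (n - k)) *+ 'C(n, k).

Lemma bernstein_ge0 n k t : 0 <= t <= 1 -> 0 <= bernstein n k t.
Proof.
by move=> /andP[t0 t1]; rewrite mulrn_wge0// mulr_ge0// exprn_ge0// subr_ge0.
Qed.

Lemma sum_bernstein n t : \sum_(k < n.+1) bernstein n k t = 1.
Proof.
have := exprDn (1 - t) t n; rewrite subrK expr1n => ->.
by apply: eq_bigr => i _; rewrite /bernstein mulrC.
Qed.

Lemma bernsteinS n k t : bernstein n.+1 k.+1 t *+ k.+1 = n.+1%:R * t * bernstein n k t.
Proof.
rewrite /bernstein subSS -mulrnA mulnC -mul_bin_diag.
rewrite -[LHS]mulr_natr natrM exprS -[_ *+ 'C(n, k)]mulr_natr; ring.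
Qed.

Lemma sum_bernstein_mean n t : \sum_(k < n.+1) k%:R * bernstein n k t = n%:R * t.
Proof.
case: n => [|n]; first by rewrite big_ord1 !mul0r.
rewrite big_ord_recl mul0r add0r.
under eq_bigr do rewrite lift0 mulr_natl bernsteinS.
by rewrite -mulr_sumr sum_bernstein mulr1.
Qed.

Lemma sum_bernstein_square n t :
  \sum_(k < n.+1) k%:R ^+ 2 * bernstein n k t = n%:R * t * (n.-1%:R * t + 1).
Proof.
case: n => [|n]; first by rewrite big_ord1 expr2 !mul0r.
rewrite big_ord_recl expr2 !mul0r add0r.
have E k : k.+1%:R ^+ 2 * bernstein n.+1 k.+1 t =
    n.+1%:R * t * (k%:R * bernstein n k t + bernstein n k t).
  rewrite expr2 -mulrA [k.+1%:R * bernstein _ _ _]mulr_natl bernsteinS.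
  by rewrite -[k.+1%:R]natr1; ring.
under eq_bigr do rewrite lift0 E.
by rewrite -mulr_sumr big_split/= sum_bernstein_mean sum_bernstein.
Qed.

(** The variance of the binomial distribution, from its first two moments. *)
Lemma sum_bernstein_variance n t :
  \sum_(k < n.+1) (k%:R - n%:R * t) ^+ 2 * bernstein n k t = n%:R * t * (1 - t).
Proof.
have E k : (k%:R - n%:R * t) ^+ 2 * bernstein n k t =
   k%:R ^+ 2 * bernstein n k t + (- 2 * (n%:R * t)) * (k%:R * bernstein n k t)
   + (n%:R * t) ^+ 2 * bernstein n k t by ring.
under eq_bigr do rewrite E.
rewrite !big_split/= -!mulr_sumr sum_bernstein_square sum_bernstein_mean sum_bernstein.
by case: n {E} => [|n]; [rewrite !mul0r; ring | rewrite -natr1/=; ring].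
Qed.

Definition bernstein_poly q n : {poly R} :=
  \sum_(k < n.+1) q (k%:R / n%:R) *: (('X ^+ k * (1 - 'X) ^+ (n - k)) *+ 'C(n, k)).

Lemma horner_bernstein q n t : (bernstein_poly q n).[t] =
  \sum_(k < n.+1) q (k%:R / n%:R) * bernstein n k t.
Proof.
rewrite /bernstein_poly horner_sum; apply: eq_bigr => k _.
rewrite hornerZ hornerMn hornerM !horner_exp hornerX hornerD hornerN hornerX hornerC. by [].

Qed.

(** Heine-Cantor: compactness in near-covering form turns radii valid around each point into one
    radius. *)
Lemma segment_unif_continuous q (a b : R) : {within `[a, b], continuous q} ->
  forall eps : R, 0 < eps -> exists2 del : R, 0 < del &
    forall s t : R, s \in `[a, b] -> t \in `[a, b] -> `|s - t| < del -> `|q s - q t| < eps.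
Proof.
move=> qc eps eps0.
pose P (del s : R) := s \in `[a, b] -> forall t, t \in `[a, b] ->
  `|s - t| < del -> `|q s - q t| < eps.
have /compact_near_coveringP/(_ _ (0^'+) P _) H := @segment_compact R a b.
have [|del /= del0 Hdel] := H _.
  move=> x xab; have /subspace_continuousP/(_ x xab)/cvgrPdist_lt := qc.
  have e2 : 0 < eps / 2 by rewrite divr_gt0.
  move=> /(_ _ e2)[r /= r0 Hr].
  have r2 : 0 < r / 2 by rewrite divr_gt0.
  near=> y del => /= yab t tab ytdel.
  have xy : `|x - y| < r / 2.
    by near: y; exists (r / 2).
  have delr : del < r / 2 by near: del; exact: nbhs_right_lt.
  have h1 : `|q x - q y| < eps / 2.
    by apply: Hr => //=; apply: lt_trans xy _; lra.
  have h2 : `|q x - q t| < eps / 2.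
    apply: Hr => //=; have -> : x - t = (x - y) + (y - t) by ring.
    by apply: le_lt_trans (ler_normD _ _) _; lra.
  have -> : q y - q t = (q x - q t) - (q x - q y) by ring.
  by apply: le_lt_trans (ler_normB _ _) _; lra.
exists (del / 2); first by rewrite divr_gt0.
move=> s t sab tab st; apply: (Hdel (del / 2) _ _ s sab sab t tab st) => /=.
- by rewrite sub0r normrN gtr0_norm ?divr_gt0// ltr_pdivrMr// ltr_pMr// ltr1n.
- by rewrite divr_gt0.
Unshelve. all: by end_near. Qed.

(* A modulus of continuity in the form that integrates against the Bernstein
   weights to their variance. *)
Lemma segment_modulus q : {within `[0, 1], continuous q} ->
  forall eps : R, 0 < eps -> exists2 C : R, 0 <= C &
    forall s t : R, s \in `[0, 1] -> t \in `[0, 1] -> `|q s - q t| <= eps + C * (s - t) ^+ 2.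
Proof.
move=> qc eps eps0.
have [del del0 H] := segment_unif_continuous q 0 1 qc eps eps0.
have [c cab cmax] : exists2 c, c \in `[0, 1] & forall t, t \in `[0, 1] -> `|q t| <= `|q c|.
  apply: (@EVT_max R (fun t => `|q t|) 0 1) => //.
  by move=> x; apply: cvg_norm; exact: qc.
set B := `|q c| in cmax; have B0 : 0 <= B by exact: normr_ge0.
have C0 : 0 <= 2 * B / del ^+ 2 by rewrite divr_ge0 ?sqr_ge0 ?mulr_ge0.
(* For points at distance at least [del] the quadratic term alone exceeds [2 * B], the largest
   possible oscillation. *)
exists (2 * B / del ^+ 2) => //.
move=> s t s1 t1; have [st|st] := ltP `|s - t| del.
  rewrite (le_trans (ltW (H s t s1 t1 st)))// lerDl.
  by rewrite mulr_ge0// sqr_ge0.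
apply: le_trans (ler_normB _ _) _.
have : 2 * B * 1 <= 2 * B * ((s - t) ^+ 2 / del ^+ 2).
  rewrite ler_wpM2l ?mulr_ge0//.
  rewrite ler_pdivlMr ?exprn_gt0// mul1r -[leRHS]real_normK ?num_real//.
  by rewrite ler_pXn2r// nnegrE ltW.
have := cmax s s1; have := cmax t t1.
rewrite [in X in _ -> _ -> _ -> X]mulrAC -[in X in _ -> _ -> _ -> X]mulrA; lra.
Qed.

Lemma weierstrass q : {within `[0, 1], continuous q} -> forall eps : R, 0 < eps ->
  exists p : {poly R}, {in `[0, 1], forall t, `|q t - p.[t]| <= eps}.
Proof.
move=> qc eps eps0.
have [|C C0 H] := segment_modulus q qc (eps / 2); first by rewrite divr_gt0.
(* The variance turns the quadratic term into at most [C / n], which this choice makes at most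
   [eps / 2]. *)
pose n := (Num.truncn (2 * C / eps)).+1.
have n0 : 0 < n%:R :> R by rewrite ltr0n.
have Cn : C / n%:R <= eps / 2.
  rewrite ler_pdivrMr// mulrC -ler_pdivrMr ?divr_gt0//.
  have -> : C / (eps / 2) = 2 * C / eps by field; rewrite gt_eqF.
  by apply: ltW; exact: truncnS_gt.
exists (bernstein_poly q n) => t t1.
have t01 : 0 <= t <= 1 by rewrite in_itv/= in t1.
have qtE : q t = \sum_(k < n.+1) q t * bernstein n k t.
  by rewrite -mulr_sumr sum_bernstein mulr1.
rewrite horner_bernstein {1}qtE -sumrB.
apply: le_trans (ler_norm_sum _ _ _) _.
apply: (@le_trans _ _ (\sum_(k < n.+1) ((eps / 2) * bernstein n k t +
   C / n%:R ^+ 2 * ((k%:R - n%:R * t) ^+ 2 * bernstein n k t)))).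
  apply: ler_sum => k _; rewrite -mulrBl normrM (ger0_norm (bernstein_ge0 _ _ _ t01)).
  have k1 : k%:R / n%:R \in `[0, 1 : R].
    by rewrite in_itv/= divr_ge0//= ler_pdivrMr// mul1r ler_nat -ltnS.
  rewrite mulrA -mulrDl ler_wpM2r ?bernstein_ge0//.
  apply: le_trans (H _ _ t1 k1) _; rewrite lerD2l.
  rewrite le_eqVlt; apply/orP; left; apply/eqP; field.
  by rewrite gt_eqF.
rewrite big_split/= -!mulr_sumr sum_bernstein mulr1 sum_bernstein_variance.
suff : C / n%:R ^+ 2 * (n%:R * t * (1 - t)) <= eps / 2 by lra.
apply: le_trans Cn.
have -> : C / n%:R ^+ 2 * (n%:R * t * (1 - t)) = C / n%:R * (t * (1 - t)).
  by field; rewrite gt_eqF.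
rewrite ler_piMr ?divr_ge0//.
have /andP[t0 t1'] := t01.
by rewrite mulr_ile1// ?subr_ge0// gerBl.
Qed.

End bernstein.


(** * Finite combinations of sines *)

Section sine_span.
Context {R : realType}.
Implicit Types f g : R -> R.

Definition sine_span f := exists N (b : nat -> R),
  forall x, f x = \sum_(1 <= n < N.+1) b n * sin (n%:R * x).

Lemma sine_sumW N M (b : nat -> R) x : (N <= M)%N ->
  \sum_(1 <= n < N.+1) b n * sin (n%:R * x) =
  \sum_(1 <= n < M.+1) (if (n <= N)%N then b n else 0) * sin (n%:R * x).
Proof.
move=> NM; rewrite [RHS](big_cat_nat (n := N.+1))//=.
rewrite [X in _ = _ + X]big_nat [X in _ = _ + X]big1 ?addr0; last first.
  by move=> i /andP[Ni _]; rewrite leqNgt Ni mul0r.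
by apply: eq_big_nat => i /andP[_]; rewrite ltnS => ->.
Qed.

Lemma sine_spanD f g : sine_span f -> sine_span g -> sine_span (fun x => f x + g x).
Proof.
move=> [N [b fE]] [M [c gE]]; exists (maxn N M).
exists (fun n => (if (n <= N)%N then b n else 0) + (if (n <= M)%N then c n else 0)) => x.
rewrite fE gE (sine_sumW N (maxn N M)) ?leq_maxl//.
rewrite (sine_sumW M (maxn N M)) ?leq_maxr// -big_split/=.
by apply: eq_bigr => i _; rewrite mulrDl.
Qed.

Lemma sine_spanZ a f : sine_span f -> sine_span (fun x => a * f x).
Proof.
move=> [N [b fE]]; exists N, (fun n => a * b n) => x.
by rewrite fE mulr_sumr; apply: eq_bigr => i _; rewrite mulrA.
Qed.

Lemma sine_span_ext f g : f =1 g -> sine_span f -> sine_span g.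
Proof. by move=> fg [N [b fE]]; exists N, b => x; rewrite -fg. Qed.

Lemma sine_span0 : sine_span (fun=> 0).
Proof. by exists 0%N, (fun=> 0) => x; rewrite big_geq. Qed.

Lemma sine_span_sin n : sine_span (fun x => sin (n%:R * x)).
Proof.
have [->|n0] := posnP n.
  by apply: sine_span_ext sine_span0 => x; rewrite mul0r sin0.
exists n, (fun i => (i == n)%:R) => x; rewrite big_nat_recr//= eqxx mul1r.
rewrite big_nat big1 ?add0r// => i /andP[_ iltn].
by rewrite ltn_eqF// mul0r.
Qed.

(** Product to sum: 2 cos x sin (n x) = sin ((n + 1) x) + sin ((n - 1) x). *)
Lemma sine_span_cos f : sine_span f -> sine_span (fun x => cos x * f x).
Proof.
move=> [N [b fE]].
suff H : sine_span (fun x => \sum_(1 <= n < N.+1) b n * (cos x * sin (n%:R * x))).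
  apply: sine_span_ext H => x; rewrite fE mulr_sumr.
  by apply: eq_bigr => i _; rewrite mulrCA.
elim: N {fE} => [|N ih].
  by apply: sine_span_ext sine_span0 => x; rewrite big_geq.
have H : sine_span (fun x => b N.+1 * (2^-1 *
    (sin (N.+2%:R * x) + sin (N%:R * x)))).
  by do 2 apply: sine_spanZ; apply: sine_spanD; exact: sine_span_sin.
apply: sine_span_ext (sine_spanD _ _ ih H) => x.
rewrite [RHS]big_nat_recr//=; congr (_ + _); congr (_ * _).
have -> : N.+2%:R * x = N.+1%:R * x + x by rewrite -[N.+2%:R]natr1 mulrDl mul1r.
have -> : N%:R * x = N.+1%:R * x - x by rewrite -[N.+1%:R]natr1; ring.
by rewrite sinD sinB; field.
Qed.

Lemma sine_span_poly (p : {poly R}) : sine_span (fun x => sin x * p.[cos x]).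
Proof.
elim/poly_ind: p => [|p c ih].
  by apply: sine_span_ext sine_span0 => x; rewrite horner0 mulr0.
apply: sine_span_ext (sine_spanD _ _ (sine_span_cos _ ih) (sine_spanZ c _ (sine_span_sin 1))).
by move=> x; rewrite hornerMXaddC mul1r; ring.
Qed.

(* Weierstrass for h as a function of (1 + cos x) / 2; the factor sin x makes
   sin x * p(cos x) a combination of sines. *)
Lemma sine_approx (h : R -> R) (eps : R) : continuous h -> 0 < eps ->
  exists N (b : nat -> R), {in `[0, pi], forall x,
    `|sin x * h x - \sum_(1 <= n < N.+1) b n * sin (n%:R * x)| <= eps}.
Proof.
move=> ch eps0.
pose c (x : R) := (1 + cos x) / 2.
pose ac (s : R) := acos (2 * s - 1).
have acK : {in `[0, pi], cancel c ac}.
  move=> x xpi; rewrite /ac /c (_ : 2 * _ - 1 = cos x) ?cosK//.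
  by field.
have cc : {within `[0, pi], continuous c}.
  apply: continuous_subspaceT => x; apply: cvgM; last exact: cvg_cst.
  by apply: cvgD; [exact: cvg_cst|exact: continuous_cos].
(* Inverse of a continuous injection; [c] decreases from 1 to 0 on [0, pi]. *)
have acc : {within `[0, 1], continuous ac}.
  have := segment_can_ge_continuous (pi_ge0 R) cc acK.
  by rewrite /c cos0 cospi subrr mul0r (_ : (1 + 1) / 2 = 1)//; field.
have qc : {within `[0, 1], continuous (h \o ac)}.
  by move=> x; apply: cvg_comp; [exact: acc|exact: ch].
have [p hp] := weierstrass (h \o ac) qc eps eps0.
have [N [b bE]] := sine_span_poly (p \Po (2^-1 *: (1 + 'X))).
exists N, b => x xpi; rewrite -bE horner_comp hornerZ hornerD hornerX hornerC.
rewrite -mulrBr normrM -[eps]mul1r ler_pM// ?sin_max//.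
have c01 : c x \in `[0, 1].
  rewrite in_itv/= /c; have := cos_geN1 x; have := cos_le1 x => h1 h2.
  by apply/andP; split; lra.
have := hp _ c01; rewrite /= acK//.
by rewrite (_ : 2^-1 * (1 + cos x) = c x)// /c mulrC.
Qed.

End sine_span.


(** * L2 as a semi-inner product space *)

Section L2.
Context {d} {T : measurableType d} {R : realType} (mu : {measure set T -> \bar R}).
Local Notation L2 := (LfunType mu (lee1n 2)).
Implicit Types f g : T -> R.

Lemma Lnorm2_sqr f :
  ('N[mu]_2%:E[EFin \o f] ^+ 2 = \int[mu]_x ((f x) ^+ 2)%:E)%E.
Proof.
have -> : (\int[mu]_x ((f x) ^+ 2)%:E = \int[mu]_x `| (EFin \o f) x | `^ 2)%E.
  by apply: eq_integral => x _ /=; rewrite powR_mulrn// real_normK ?num_real.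
rewrite -powR_Lnorm//.
have := Lnorm_ge0 mu 2%:E (EFin \o f).
case: ('N[mu]_2%:E[EFin \o f])%E => [r||]//.
- by rewrite lee_fin => r0; rewrite poweR_EFin powR_mulrn// EFin_expe.
- by rewrite poweRyr// expe2 mulyy.
Qed.

Lemma Lfun2P f : measurable_fun [set: T] f ->
  (\int[mu]_x ((f x) ^+ 2)%:E < +oo)%E -> f \in Lfun mu 2%:E.
Proof.
move=> mf f2; rewrite inE; apply/andP; split; rewrite inE//=.
rewrite /finite_norm ltNge leye_eq; apply/negP => /eqP h.
by move: f2; rewrite -Lnorm2_sqr h expe2 mulyy ltxx.
Qed.

Lemma Lfun2_mul_integrable f g : f \in Lfun mu 2%:E -> g \in Lfun mu 2%:E ->
  mu.-integrable [set: T] (EFin \o (fun x => f x * g x)).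
Proof. by move=> f2 g2; apply/Lfun1_integrable; exact: Lfun2_mul_Lfun1. Qed.

Definition L2_ip (f g : L2) : R := \int[mu]_x (f x * g x).

Lemma L2_semi_inner_product : semi_inner_product L2_ip.
Proof.
split=> [f g|f g h|a f g|f]; rewrite /L2_ip.
- by apply: eq_Rintegral => x _; rewrite mulrC.
- rewrite -RintegralD//; try by apply: Lfun2_mul_integrable; exact: LfunP.
  by apply: eq_Rintegral => x _; rewrite -mulrDl.
- rewrite -RintegralZl//; last by apply: Lfun2_mul_integrable; exact: LfunP.
  by apply: eq_Rintegral => x _; rewrite mulrA.
- by apply: Rintegral_ge0 => x _; rewrite -expr2 sqr_ge0.
Qed.

Lemma Lnorm2_ip (f : L2) : ('N[mu]_2%:E[EFin \o f] ^+ 2 = (L2_ip f f)%:E)%E.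
Proof.
rewrite Lnorm2_sqr /L2_ip /Rintegral fineK//.
by apply: integrable_fin_num => //; apply: Lfun2_mul_integrable; exact: LfunP.
Qed.

Lemma Lnorm2_lt (f : L2) (e : R) : ip_norm L2_ip f < e ->
  ('N[mu]_2%:E[EFin \o f] < e%:E)%E.
Proof.
move=> fe; have e0 : 0 < e by apply: le_lt_trans fe; exact: sqrtr_ge0.
apply: lte_sqrE; first by rewrite lee_fin ltW.
rewrite Lnorm2_ip -EFin_expe lte_fin -(ip_norm_sqr _ L2_semi_inner_product).
by rewrite ltr_pXn2r// nnegrE ?(ltW e0)// sqrtr_ge0.
Qed.

Lemma L2_sumE (I : Type) (r : seq I) (P : pred I) (F : I -> L2) x :
  (\sum_(i <- r | P i) F i) x = \sum_(i <- r | P i) F i x.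
Proof. by apply: (big_ind2 (fun (f : L2) y => f x = y)) => // f _ g _ <- <-. Qed.

End L2.


(** * Truncation and density of the sines for the restricted measure *)

Section lebesgue_0pi.
Context {R : realType}.
Local Notation leb := (@lebesgue_measure R).
Local Notation mu0 := (@lebesgue_0pi R).
Local Notation D := (`]0%R, pi[%classic : set R).
Implicit Types f g h : R -> R.

Lemma measurable_0pi : measurable D.
Proof. exact: measurable_itv. Qed.
Local Notation mD := measurable_0pi.

Lemma lebesgue_measure_0pi : leb D = pi%:E.
Proof. by rewrite lebesgue_measure_itv/= lte_fin pi_gt0 oppr0 adde0. Qed.

Lemma lebesgue_0pi_lty : (leb D < +oo)%E.
Proof. by rewrite lebesgue_measure_0pi ltry. Qed.

Lemma lebesgue_0pi_setC : mu0 (~` D) = 0%E.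
Proof. by rewrite /lebesgue_0pi/= /mrestr setICl measure0. Qed.

Lemma ge0_integral_0pi (F : R -> \bar R) :
  measurable_fun [set: R] F -> (forall x, 0 <= F x)%E ->
  (\int[mu0]_x F x = \int[leb]_(x in D) F x)%E.
Proof.
move=> mF F0; rewrite (@ge0_negligible_integral _ _ _ mu0 _ (~` D))//; last 2 first.
- exact: measurableC.
- exact: lebesgue_0pi_setC.
rewrite setTD setCK; apply: eq_measure_integral => A mA AD.
by rewrite /lebesgue_0pi/= /mrestr setIidl.
Qed.

Lemma integrable_0pi (F : R -> \bar R) :
  mu0.-integrable [set: R] F -> leb.-integrable D F.
Proof.
move=> /integrableP[mF iF]; apply/integrableP; split; first exact: measurable_funTS.
by rewrite -ge0_integral_0pi//; exact: measurableT_comp.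
Qed.

Lemma integral_0pi (F : R -> \bar R) : mu0.-integrable [set: R] F ->
  (\int[mu0]_x F x = \int[leb]_(x in D) F x)%E.
Proof.
move=> iF; rewrite (@negligible_integral _ _ _ mu0 _ (~` D))//; last 2 first.
- exact: measurableC.
- exact: lebesgue_0pi_setC.
rewrite setTD setCK; apply: eq_measure_integral => A mA AD.
by rewrite /lebesgue_0pi/= /mrestr setIidl.
Qed.

Lemma bounded_Lfun2 h K : measurable_fun D h -> {in `]0, pi[, forall x, `|h x| <= K} ->
  h \_ D \in Lfun mu0 2%:E.
Proof.
move=> mh hK; have mhD : measurable_fun [set: R] (h \_ D).
  by apply/(measurable_restrictT _ mD).
apply: Lfun2P => //; rewrite ge0_integral_0pi//; last 2 first.
- by apply/measurable_EFinP; exact: measurable_funX.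
- by move=> x; rewrite lee_fin sqr_ge0.
apply: (@le_lt_trans _ _ (\int[leb]_(x in D) (K ^+ 2)%:E)%E); last first.
  by rewrite integral_cst//= lebesgue_measure_0pi -EFinM ltry.
apply: ge0_le_integral => //.
- by move=> x _; rewrite lee_fin sqr_ge0.
- by apply/measurable_EFinP; apply: measurable_funTS; exact: measurable_funX.
- move=> x xD; rewrite lee_fin patchE mem_set//.
  rewrite -[leLHS]real_normK ?num_real// lerXn2r ?nnegrE//; last exact: hK.
  by apply: le_trans (hK x xD).
Qed.

Lemma continuous_Lfun2 h : {within `[0, pi], continuous h} ->
  h \_ D \in Lfun mu0 2%:E.
Proof.
move=> ch.
have [c cpi cmax] : exists2 c, c \in `[0, pi] & forall t, t \in `[0, pi] -> `|h t| <= `|h c|.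
  apply: (@EVT_max R (fun t => `|h t|) 0 pi); first exact: pi_ge0.
  by move=> x; apply: cvg_norm; exact: ch.
apply: (bounded_Lfun2 _ `|h c|).
  apply: (@measurable_funS _ _ _ _ `[0, pi]%classic) => //.
    by apply: subset_itv; rewrite bnd_simp.
  by apply: subspace_continuous_measurable_fun.
by move=> x xpi; apply: cmax; apply: subset_itv xpi; rewrite bnd_simp.
Qed.

Definition clamp (K t : R) := Num.max (- K) (Num.min t K).

Lemma clampP K t : 0 <= K -> [\/ t <= - K /\ clamp K t = - K,
  (- K <= t <= K) /\ clamp K t = t | K <= t /\ clamp K t = K].
Proof.
move=> K0; rewrite /clamp; have [tK|tK] := leP t K; last first.
  by constructor 3; split; [exact: ltW|apply/max_idPr; lra].
have [Kt|Kt] := leP (- K) t.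
  by constructor 2.
by constructor 1; split=> //; exact: ltW.
Qed.

Lemma clamp_norm K t : 0 <= K -> `|clamp K t| <= K.
Proof.
move=> K0; rewrite ler_norml.
by have [[h ->]|[h ->]|[h ->]] := clampP K t K0; lra.
Qed.

Lemma clamp_lip K s t : 0 <= K -> `|clamp K s - clamp K t| <= `|s - t|.
Proof.
move=> K0; have h1 := ler_norm (s - t); have h2 := ler_norm (- (s - t)).
rewrite normrN in h2; rewrite ler_norml.
have [[h ->]|[/andP[? ?] ->]|[h ->]] := clampP K s K0;
have [[h' ->]|[/andP[? ?] ->]|[h' ->]] := clampP K t K0; apply/andP; split; lra.
Qed.

Lemma clamp_residual K t : 0 <= K -> `|t - clamp K t| <= `|t|.
Proof.
move=> K0; have h1 := ler_norm t; have h2 := ler_norm (- t).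
rewrite normrN in h2; rewrite ler_norml.
have [[h ->]|[/andP[? ?] ->]|[h ->]] := clampP K t K0; apply/andP; split; lra.
Qed.

Lemma clamp_id K t : `|t| <= K -> clamp K t = t.
Proof.
by rewrite ler_norml => /andP[h1 h2]; rewrite /clamp (min_idPl h2) (max_idPr h1).
Qed.

Lemma continuous_clamp K f : continuous f -> continuous (clamp K \o f).
Proof.
move=> cf x; apply: (@continuous_max R R (cst (- K)) (f \min cst K)).
  exact: cvg_cst.
by apply: (@continuous_min R R f (cst K)); [exact: cf|exact: cvg_cst].
Qed.

Lemma measurable_clamp (E : set R) K f : measurable_fun E f ->
  measurable_fun E (clamp K \o f).
Proof.
by move=> mf; apply: measurable_maxr => //; exact: measurable_minr.
Qed.

Lemma sin_0pi_gt0 x : x \in `]0, pi[ -> 0 < sin x :> R.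
Proof. by rewrite in_itv/= => /sin_gt0_pi. Qed.

Lemma measurable_quotient_sin g : measurable_fun D g ->
  measurable_fun D (fun x => g x / sin x).
Proof.
move=> mg; apply: measurable_funM => //.
apply: open_continuous_measurable_fun; first exact: interval_open.
move=> x; rewrite inE => xpi; apply: cvgV; last exact: continuous_sin.
by rewrite gt_eqF// sin_0pi_gt0.
Qed.

(* g is divided by sin before truncation because the approximants that
   [sine_approx] can handle have the form sin x * h x. *)
Lemma truncated_quotient_cvg g : measurable_fun D g ->
  leb.-integrable D (EFin \o (fun x => g x ^+ 2)) ->
  (\int[leb]_(x in D) ((g x - sin x * clamp n%:R (g x / sin x)) ^+ 2)%:E)%E
    @[n --> \oo] --> 0%E.
Proof.
move=> mg ig.
have := @dominated_cvg _ _ R leb D mD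
  (fun n x => ((g x - sin x * clamp n%:R (g x / sin x)) ^+ 2)%:E) (cst 0%E)
  (EFin \o (fun x => g x ^+ 2)).
rewrite integral0; apply => //.
- move=> n; apply/measurable_EFinP; apply: measurable_funX; apply: measurable_funB => //.
  apply: measurable_funM; last first.
    exact: (measurable_clamp D _ _ (measurable_quotient_sin _ mg)).
  by apply: measurable_funTS; apply: continuous_measurable_fun; exact: continuous_sin.
- move=> x xpi; have sx := sin_0pi_gt0 x xpi.
  (* At a fixed point the truncation is inactive once [n] exceeds the absolute value of the
     quotient. *)
  apply: cvg_near_cst; near=> n.
  rewrite clamp_id; first by rewrite mulrCA divff ?gt_eqF// mulr1 subrr expr0n.
  by near: n; exact: nbhs_infty_ger.
- move=> n x xpi; have sx := sin_0pi_gt0 x xpi.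
  rewrite /= lee_fin ger0_norm ?sqr_ge0// -[leRHS]real_normK ?num_real//.
  rewrite -[leLHS]real_normK ?num_real// lerXn2r ?nnegrE//.
  set y := g x / sin x.
  have -> : g x = sin x * y by rewrite mulrCA divff ?gt_eqF// mulr1.
  rewrite -mulrBr !(normrM (sin x)) ler_wpM2l//.
  exact: clamp_residual.
Unshelve. all: by end_near. Qed.

(** L1 density of continuous functions suffices: clamping the approximant keeps it as close to [q],
    and then the squared error is at most [2 * K] times the error. *)
Lemma truncated_continuous_approx (q : R -> R) (K eta : R) : 0 <= K -> 0 < eta ->
  measurable_fun D q -> {in `]0, pi[, forall x, `|q x| <= K} ->
  exists2 h, continuous h &
    (\int[leb]_(x in D) ((sin x * q x - sin x * h x) ^+ 2)%:E <= eta%:E)%E.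
Proof.
move=> K0 eta0 mq qK.
have iq : leb.-integrable D (EFin \o q).
  apply: measurable_bounded_integrable => //.
    exact: lebesgue_0pi_lty.
  exists K; split; first exact: num_real.
  by move=> M KM x xpi; apply: le_trans (qK x xpi) (ltW KM).
have [|g_ [cg ig]] := @approximation_continuous_integrable R D q mD _ iq.
  exact: lebesgue_0pi_lty.
(* The added 1 covers [K = 0]. *)
pose del := eta / (2 * K + 1).
have K1 : 0 < 2 * K + 1 by lra.
have del0 : 0 < del by rewrite divr_gt0.
move=> /fine_cvgP[[M1 _ H1]] /cvgrPdist_lt/(_ _ del0)[M2 _ H2].
pose n := maxn M1 M2.
have {}H1 := H1 n (leq_maxl _ _); have {}H2 := H2 n (leq_maxr _ _).
exists (clamp K \o g_ n); first exact: continuous_clamp.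
have mgn : measurable_fun D (g_ n).
  by apply: measurable_funTS; exact: continuous_measurable_fun.
have mqg : measurable_fun D (fun x => `|q x - g_ n x|).
  by apply: measurableT_comp => //; exact: measurable_funB.
apply: (@le_trans _ _ (\int[leb]_(x in D) ((2 * K)%:E * `|(q x - g_ n x)%:E|))%E).
  apply: ge0_le_integral => //.
  - by move=> x _; rewrite lee_fin sqr_ge0.
  - have ms : measurable_fun D (@sin R).
      by apply: measurable_funTS; apply: continuous_measurable_fun; exact: continuous_sin.
    apply/measurable_EFinP; apply: measurable_funX; apply: measurable_funB.
      exact: measurable_funM.
    by apply: measurable_funM => //; exact: measurable_clamp.
  - apply: measurable_funeM; apply/measurable_EFinP; exact: mqg.
  - move=> x xpi; rewrite -EFinM lee_fin /=.
    have qx := qK x xpi.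
    have hx := clamp_norm K (g_ n x) K0.
    have qc : `|q x - clamp K (g_ n x)| <= `|q x - g_ n x|.
      by rewrite -{1}(clamp_id K (q x) qx); exact: clamp_lip.
    have qc2 : `|q x - clamp K (g_ n x)| <= 2 * K.
      by apply: le_trans (ler_normB _ _) _; lra.
    rewrite -mulrBr exprMn -[leRHS]mul1r ler_pM ?sqr_ge0//.
    by rewrite -[leLHS]real_normK ?num_real// expr2 ler_pM.
rewrite ge0_integralZl//; last 2 first.
- by apply/measurable_EFinP; exact: mqg.
- by rewrite lee_fin mulr_ge0.
rewrite -(fineK H1) -EFinM lee_fin.
rewrite /= sub0r normrN in H2.
have {}H2 := le_lt_trans (ler_norm _) H2.
apply: (@le_trans _ _ (2 * K * del)); first by rewrite ler_wpM2l ?mulr_ge0// ltW.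
rewrite /del mulrCA ger_pMr// ler_pdivrMr//; lra.
Qed.

Lemma sqr_sum3 (u v w : R) : (u + v + w) ^+ 2 <= 3 * (u ^+ 2 + (v ^+ 2 + w ^+ 2)).
Proof.
have := sqr_ge0 (u - v); have := sqr_ge0 (u - w); have := sqr_ge0 (v - w).
rewrite !sqrrB !sqrrD; lra.
Qed.

Lemma sine_dense g (eta : R) : 0 < eta -> measurable_fun D g ->
  leb.-integrable D (EFin \o (fun x => g x ^+ 2)) ->
  exists N (b : nat -> R), (\int[leb]_(x in D)
    ((g x - \sum_(1 <= n < N.+1) b n * sin (n%:R * x)) ^+ 2)%:E < eta%:E)%E.
Proof.
move=> eta0 mg ig.
(* Three errors (truncation, continuity, sine polynomial) of at most [eta / 12] each, times the
   factor 3 of [sqr_sum3], leave 3 eta / 4. *)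
have eta12 : 0 < eta / 12 by rewrite divr_gt0.
have /fine_cvgP[[M1 _ H1] /cvgrPdist_lt/(_ _ eta12)[M2 _ H2]] :=
  truncated_quotient_cvg g mg ig.
pose K := maxn M1 M2; pose q x := clamp K%:R (g x / sin x).
have {}H1 := H1 K (leq_maxl _ _); have {}H2 := H2 K (leq_maxr _ _).
rewrite /= sub0r normrN in H2; have {}H2 := le_lt_trans (ler_norm _) H2.
have mq : measurable_fun D q.
  exact: (measurable_clamp D _ _ (measurable_quotient_sin _ mg)).
have qK : {in `]0, pi[, forall x, `|q x| <= K%:R} by move=> x _; exact: clamp_norm.
have [h ch hh] := truncated_continuous_approx q K%:R (eta / 12) (ler0n _ _) eta12 mq qK.
pose eps := Num.sqrt (eta / 12 / pi).
have eps_gt0 : 0 < eps by rewrite sqrtr_gt0 divr_gt0// pi_gt0.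
have eps2 : eps ^+ 2 * pi = eta / 12.
  by rewrite sqr_sqrtr ?divfK ?gt_eqF ?pi_gt0// divr_ge0 ?pi_ge0// ltW.
have [N [b hb]] := sine_approx h eps ch eps_gt0.
exists N, b; set S := fun x => \sum_(1 <= n < N.+1) b n * sin (n%:R * x).
have ms : measurable_fun D (@sin R).
  by apply: measurable_funTS; apply: continuous_measurable_fun; exact: continuous_sin.
have mS : measurable_fun D S.
  apply: measurable_sum => n; apply: measurable_funM => //.
  apply: measurable_funTS; apply: continuous_measurable_fun => x.
  by apply/differentiable_continuous/derivable1_diffP; apply: ex_derive.
have mh : measurable_fun D h.
  by apply: measurable_funTS; apply: continuous_measurable_fun.
pose F1 x := (g x - sin x * q x) ^+ 2; pose F2 x := (sin x * q x - sin x * h x) ^+ 2.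
have mF1 : measurable_fun D F1.
  by apply: measurable_funX; apply: measurable_funB => //; exact: measurable_funM.
have mF2 : measurable_fun D F2.
  by apply: measurable_funX; apply: measurable_funB; exact: measurable_funM.
apply: (@le_lt_trans _ _ (\int[leb]_(x in D) (3%:E * ((F1 x)%:E + ((F2 x)%:E + (eps ^+ 2)%:E))))%E).
  apply: ge0_le_integral => //.
  - by move=> x _; rewrite lee_fin sqr_ge0.
  - by apply/measurable_EFinP; apply: measurable_funX; exact: measurable_funB.
  - apply: measurable_funeM; apply: emeasurable_funD; first exact/measurable_EFinP.
    by apply: emeasurable_funD => //; exact/measurable_EFinP.
  - move=> x xpi; rewrite -!EFinD -EFinM lee_fin.
    have xpi' : x \in `[0, pi] by apply: subset_itv xpi; rewrite bnd_simp.
    have := hb _ xpi'; rewrite -/(S x).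
    have -> : g x - S x = (g x - sin x * q x) + (sin x * q x - sin x * h x) +
      (sin x * h x - S x) by ring.
    rewrite /F1 /F2; set A := g x - _; set B := sin x * q x - _; set E := _ - S x => hE.
    have E2 : E ^+ 2 <= eps ^+ 2.
      by rewrite -[leLHS]real_normK ?num_real// lerXn2r ?nnegrE// ltW.
    by apply: le_trans (sqr_sum3 A B E) _; rewrite ler_pM2l// !lerD2l.
have F1_0 x : D x -> (0 <= (F1 x)%:E)%E by rewrite lee_fin sqr_ge0.
have F2_0 x : D x -> (0 <= (F2 x)%:E)%E by rewrite lee_fin sqr_ge0.
have e_0 (x : R) : D x -> (0 <= (eps ^+ 2)%:E)%E by rewrite lee_fin sqr_ge0.
rewrite ge0_integralZl//; last 2 first.
- apply: emeasurable_funD; first exact/measurable_EFinP.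
  by apply: emeasurable_funD => //; exact/measurable_EFinP.
- by move=> x xD; rewrite !adde_ge0// ?F1_0 ?F2_0 ?(e_0 x).
rewrite ge0_integralD//; last 3 first.
- exact/measurable_EFinP.
- by move=> x xD; rewrite adde_ge0// ?F2_0 ?(e_0 x).
- by apply: emeasurable_funD => //; exact/measurable_EFinP.
rewrite ge0_integralD//; last exact/measurable_EFinP.
rewrite integral_cst//= lebesgue_measure_0pi.
apply: (@le_lt_trans _ _ (3%:E * ((eta / 12)%:E + ((eta / 12)%:E + (eps ^+ 2)%:E * pi%:E)))%E).
  rewrite lee_pmul2l// leeD// ?leeD//.
  by rewrite -(fineK H1) lee_fin ltW.
by rewrite -(EFinM (eps ^+ 2)) eps2 -!EFinD -EFinM lte_fin; lra.
Qed.

End lebesgue_0pi.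


(** * The Riesz basis property *)

(** A finite piece of the tail is at most the limit minus the partial sum before it. *)
Lemma nonneg_series_tail {R : realType} (c : nat -> R) (m : nat) :
  (forall n, 0 <= c n) -> (\sum_(m <= n <oo) (c n)%:E < +oo)%E ->
  forall eta : R, 0 < eta -> exists2 M, (m <= M)%N &
    forall N, \sum_(M <= n < N) c n <= eta.
Proof.
move=> c0 csum eta eta0.
have c0e k (P : pred nat) : (forall n, (k <= n)%N -> P n -> 0 <= (c n)%:E)%E.
  by move=> n _ _; rewrite lee_fin.
have cfin : (\sum_(m <= n <oo) (c n)%:E)%E \is a fin_num.
  by rewrite ge0_fin_numE// nneseries_ge0// => n _ _; rewrite lee_fin.
have := @is_cvg_nneseries _ (fun n => (c n)%:E) xpredT m (c0e m xpredT).
set L := (\sum_(m <= n <oo) (c n)%:E)%E in csum cfin *.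
move=> cvgL; have {}cvgL : (fun k => \sum_(m <= n < k) (c n)%:E)%E @ \oo --> L by [].
have /fine_cvgP[_ /cvgrPdist_lt/(_ _ eta0)[M _ HM]] :
    (fun k => \sum_(m <= n < k) (c n)%:E)%E @ \oo --> (fine L)%:E.
  by rewrite fineK.
exists (maxn m M); first exact: leq_maxl.
move=> N; set M' := maxn m M.
have [NM|MN] := leqP N M'; first by rewrite big_geq// ltW.
have := HM M' (leq_maxr _ _); rewrite /= sumEFin /= => h.
have LN : \sum_(m <= n < N) c n <= fine L.
  by rewrite -lee_fin fineK// -sumEFin; apply: nneseries_lim_ge => n _ _; rewrite lee_fin.
rewrite (big_cat_nat (n := M'))/= ?leq_maxl// in LN; last exact: ltnW.
have := le_lt_trans (ler_norm _) h; move: LN; lra.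
Qed.

(** * The sines as an orthogonal basis of L2(0, pi) *)

Section assembly.
Context {R : realType}.
Local Notation leb := (@lebesgue_measure R).
Local Notation mu0 := (@lebesgue_0pi R).
Local Notation D := (`]0%R, pi[%classic : set R).
Local Notation L2 := (LfunType mu0 (lee1n 2)).

Lemma L2_ip_0pi (u v : L2) : L2_ip _ u v = \int[leb]_(x in D) (u x * v x).
Proof.
rewrite /L2_ip /Rintegral integral_0pi//.
by apply: Lfun2_mul_integrable; exact: LfunP.
Qed.

Lemma Rintegral_open_segment (h : R -> R) : {within `[0, pi], continuous h} ->
  \int[leb]_(x in D) h x = \int[leb]_(x in `[0, pi]) h x.
Proof.
move=> ch; have ih := segment_integrable h 0 pi ch.
rewrite Rintegral_itv_bndo_bndc ?Rintegral_itv_obnd_cbnd//.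
  by apply: integrableS ih => //; apply: subset_itv; rewrite bnd_simp.
by apply: integrableS ih => //; apply: subset_itv; rewrite bnd_simp.
Qed.

Lemma L2_ip_restrict (u v : L2) (f g : R -> R) :
  {within `[0, pi], continuous f} -> {within `[0, pi], continuous g} ->
  (u : R -> R) = f \_ D -> (v : R -> R) = g \_ D ->
  L2_ip _ u v = \int[leb]_(x in `[0, pi]) (f x * g x).
Proof.
move=> cf cg uf vg; rewrite L2_ip_0pi -Rintegral_open_segment; last first.
  by move=> x; apply: cvgM; [exact: cf|exact: cg].
by apply: eq_Rintegral => x xD; rewrite uf vg !patchE xD.
Qed.

Lemma L2_ip_le (u : L2) (B : R) : 0 <= B -> {in `]0, pi[, forall x, `|u x| <= B} ->
  L2_ip _ u u <= B ^+ 2 * pi.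
Proof.
move=> B0 uB; rewrite L2_ip_0pi.
have iu : leb.-integrable D (EFin \o (fun x => u x * u x)).
  by apply: integrable_0pi; apply: Lfun2_mul_integrable; exact: LfunP.
have -> : B ^+ 2 * pi = \int[leb]_(x in D) (B ^+ 2).
  by rewrite Rintegral_cst//= lebesgue_measure_0pi.
apply: le_Rintegral => //.
  apply: measurable_bounded_integrable => //; first exact: lebesgue_0pi_lty.
  exists (B ^+ 2); split; first exact: num_real.
  by move=> M BM x _ /=; rewrite ger0_norm ?sqr_ge0// ltW.
move=> x xD; rewrite -expr2 -[leLHS]real_normK ?num_real// lerXn2r ?nnegrE//.
exact: uB.
Qed.

Definition sine_L2 (n : nat) : L2 :=
  Lfun_Sub (lee1n 2) (continuous_Lfun2 _ (continuous_subspaceT (continuous_sin_lin n%:R))).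

Lemma sine_L2E n : (sine_L2 n : R -> R) = (fun x => sin (n%:R * x)) \_ D.
Proof. by []. Qed.

Lemma sine_L2_orth m n : (0 < m)%N -> (0 < n)%N ->
  L2_ip _ (sine_L2 m) (sine_L2 n) = if m == n then pi / 2 else 0.
Proof.
move=> m0 n0; rewrite -sine_orthogonality//.
by apply: (L2_ip_restrict _ _ (fun x => sin (m%:R * x)) (fun x => sin (n%:R * x)));
  rewrite ?sine_L2E//; apply: continuous_subspaceT; exact: continuous_sin_lin.
Qed.

Lemma sine_L2_dense (u : L2) (eta : R) : 0 < eta -> exists N (b : nat -> R),
  ip_norm (L2_ip mu0) (u - \sum_(1 <= n < N.+1) b n *: sine_L2 n) < eta.
Proof.
move=> eta0; have mu : measurable_fun D u.
  by apply: measurable_funTS; have /andP[] := LfunP u; rewrite inE.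
have iu : leb.-integrable D (EFin \o (fun x => u x ^+ 2)).
  by apply: integrable_0pi; apply: Lfun2_integrable_sqr; exact: LfunP.
have [|N [b hb]] := sine_dense u (eta ^+ 2) _ mu iu; first by rewrite exprn_gt0.
exists N, b; rewrite -[eta]gtr0_norm// -sqrtr_sqr ltr_sqrt ?exprn_gt0// L2_ip_0pi.
rewrite -lte_fin; apply: le_lt_trans hb.
rewrite /Rintegral fineK; last first.
  apply: integrable_fin_num => //; apply: integrable_0pi.
  by apply: Lfun2_mul_integrable; exact: LfunP.
rewrite le_eqVlt; apply/orP; left; apply/eqP; apply: eq_integral => x xD.
rewrite -expr2; congr (_ ^+ 2)%:E.
have -> : (u - \sum_(1 <= n < N.+1) b n *: sine_L2 n) x =
    u x - (\sum_(1 <= n < N.+1) b n *: sine_L2 n) x by [].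
rewrite L2_sumE; congr (_ - _); apply: eq_bigr => n _.
have -> : (b n *: sine_L2 n) x = b n * sine_L2 n x by [].
by rewrite sine_L2E patchE xD.
Qed.

End assembly.


(** * Checking the hypotheses of the perturbation argument *)

Section fucik_system_properties.
Context {R : realType}.
Local Notation mu0 := (@lebesgue_0pi R).
Local Notation D := (`]0%R, pi[%classic : set R).
Local Notation L2 := (LfunType mu0 (lee1n 2)).
Variables (alpha beta : nat -> R) (f : nat -> R -> R).
Hypothesis hF : fucik_system alpha beta f.
Hypothesis hodd : forall n : nat, odd n -> alpha n = n%:R ^+ 2 /\ beta n = n%:R ^+ 2.

Lemma fucik_system_odd n : odd n -> {in `[0, pi], forall x, f n x = sin (n%:R * x)}.
Proof.
move=> on; have [_ _ f1 fn] := hF.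
have [n1|n1] := leqP n 1.
  have -> : n = 1%N by case: n n1 on => [|[|]].
  by move=> x /f1 ->; rewrite mul1r.
apply: normalized_linear; first exact: odd_gt0.
by have := fn n n1; have [-> ->] := hodd n on.
Qed.

Lemma fucik_system_continuous n : (0 < n)%N -> {within `[0, pi], continuous (f n)}.
Proof.
move=> n0; have [_ _ _ fn] := hF.
have [on|en] := boolP (odd n).
  have E : {in `[0, pi]%classic, (fun x => sin (n%:R * x)) =1 f n}.
    by move=> x; rewrite inE => xpi; rewrite fucik_system_odd.
  apply: (subspace_eq_continuous E).
  by apply: continuous_subspaceT; exact: continuous_sin_lin.
have n2 : (1 < n)%N by case: n n0 en => [|[|]].
by have [[]] := fn n n2.
Qed.

Lemma fucik_system_Lfun n : (0 < n)%N -> f n \_ D \in Lfun mu0 2%:E.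
Proof. by move=> n0; apply: continuous_Lfun2; exact: fucik_system_continuous. Qed.

(* Junk value 0 when f n is not in L2, which can only happen for n = 0. *)
Definition fucik_L2 n : L2 := insubd (0 : L2) (f n \_ D).

Lemma fucik_L2E n : (0 < n)%N -> (fucik_L2 n : R -> R) = f n \_ D.
Proof. by move=> n0; exact: (insubdK (0 : L2) (fucik_system_Lfun n n0)). Qed.

Lemma fucik_L2_odd n : odd n -> fucik_L2 n = sine_L2 n.
Proof.
move=> on; apply/LfuneqP => x; rewrite fucik_L2E ?odd_gt0// sine_L2E !patchE.
case: ifPn => //; rewrite inE => xpi; apply: fucik_system_odd => //.
by apply: subset_itv xpi; rewrite bnd_simp.
Qed.

Lemma fucik_L2_ip n m : (0 < n)%N -> L2_ip _ (fucik_L2 n) (sine_L2 m) =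
  \int[lebesgue_measure]_(x in `[0, pi]) (f n x * sin (m%:R * x)).
Proof.
move=> n0; apply: L2_ip_restrict; [exact: fucik_system_continuous| |exact: fucik_L2E|by []].
by apply: continuous_subspaceT; exact: continuous_sin_lin.
Qed.

Lemma even_double n : ~~ odd n -> (2 * n./2)%N = n.
Proof. by move=> en; rewrite mul2n even_halfK. Qed.

Lemma fucik_curve_even n : (0 < n)%N -> ~~ odd n ->
  fucik_curve (2 * n./2) (alpha n, beta n) /\
  normalized_fucik_eigenfunction (alpha n) (beta n) (f n).
Proof.
move=> n0 en; have [_ fc _ fn] := hF.
have n2 : (1 < n)%N by case: n n0 en => [|[|]].
by rewrite even_double//; split; [exact: fc|exact: fn].
Qed.

Lemma half_gt0 n : (0 < n)%N -> ~~ odd n -> (0 < n./2)%N.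
Proof. by case: n => [|[|]]. Qed.

Lemma fucik_L2_triangular m n : (0 < m < n)%N -> ~~ odd m -> ~~ odd n ->
  L2_ip _ (fucik_L2 n) (sine_L2 m) = 0.
Proof.
move=> /andP[m0 mn] em en; have n0 : (0 < n)%N by exact: leq_ltn_trans mn.
rewrite fucik_L2_ip// -(even_double m em).
have [curve nu] := fucik_curve_even n n0 en.
have [al0 be0 kl uc uE] := normalized_periodic _ _ _ _ (half_gt0 n n0 en) curve nu.
apply: (fucik_even_orth n./2 (alpha n) (beta n)
  (Num.min (Num.sqrt (alpha n)) (Num.sqrt (beta n)))) => //.
- exact: half_gt0.
- by rewrite half_gt0//= -(@ltn_pmul2l 2)// !even_double.
Qed.

Lemma fucik_L2_diag n : (0 < n)%N -> ~~ odd n ->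
  L2_ip _ (fucik_L2 n) (sine_L2 n) != 0.
Proof.
move=> n0 en; rewrite fucik_L2_ip//.
have [curve nu] := fucik_curve_even n n0 en.
have [al0 be0 kl uc uE] := normalized_periodic _ _ _ _ (half_gt0 n n0 en) curve nu.
rewrite gt_eqF// -[X in X%:R](even_double n en).
apply: (fucik_even_diag n./2 (alpha n) (beta n)
  (Num.min (Num.sqrt (alpha n)) (Num.sqrt (beta n)))) => //.
- exact: half_gt0.
- by rewrite lt_min !sqrtr_gt0 al0.
Qed.

Definition fucik_defect n : R :=
  Num.max (Num.sqrt (alpha n)) (Num.sqrt (beta n)) / n%:R - 1.

(** The uniform bound with constant 6, squared and integrated over length pi; at odd [n] the left
    side is 0. *)
Lemma fucik_L2_close n : (0 < n)%N ->
  L2_ip _ (fucik_L2 n - sine_L2 n) (fucik_L2 n - sine_L2 n) <=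
  36 * pi * fucik_defect n ^+ 2.
Proof.
move=> n0; have [on|en] := boolP (odd n).
  rewrite fucik_L2_odd// subrr (ip0l _ (L2_semi_inner_product _)).
  by rewrite mulr_ge0 ?sqr_ge0// mulr_ge0// pi_ge0.
have [curve nu] := fucik_curve_even n n0 en.
have close := fucik_even_close _ _ _ _ (half_gt0 n n0 en) curve nu.
rewrite even_double// -/(fucik_defect n) in close.
have -> : 36 * pi * fucik_defect n ^+ 2 = (6 * fucik_defect n) ^+ 2 * pi by ring.
(* Nonnegative because it bounds an absolute value at 0. *)
have s0 : 0 <= 6 * fucik_defect n.
  by apply: le_trans (close 0 _); rewrite // in_itv/= lexx pi_ge0.
apply: L2_ip_le => // x xpi.
have -> : (fucik_L2 n - sine_L2 n) x = fucik_L2 n x - sine_L2 n x by [].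
rewrite fucik_L2E// sine_L2E !patchE mem_set//.
by apply: close; apply: subset_itv xpi; rewrite bnd_simp.
Qed.

Hypothesis hsum : (\sum_(2 <= n <oo) (fucik_defect n ^+ 2)%:E < +oo)%E.

Lemma fucik_L2_close_tail (eta : R) : 0 < eta -> exists M, forall N,
  \sum_(M <= n < N) L2_ip _ (fucik_L2 n - sine_L2 n) (fucik_L2 n - sine_L2 n) <= eta.
Proof.
move=> eta0; have c0 : 0 < 36 * pi :> R by rewrite mulr_gt0// pi_gt0.
have [|M M2 HM] := nonneg_series_tail _ _
  (fun n => sqr_ge0 (fucik_defect n)) hsum (eta / (36 * pi)).
  by rewrite divr_gt0.
exists M => N; have := HM N; rewrite ler_pdivlMr// mulrC mulr_sumr.
apply: le_trans; rewrite ler_sum_nat// => n /andP[Mn _].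
by apply: fucik_L2_close; apply: leq_trans Mn; exact: leq_trans M2.
Qed.

Lemma lin_combE N (a : nat -> R) :
  (\sum_(1 <= n < N.+1) a n *: fucik_L2 n : L2) =
  @lin_comb _ (measurableTypeR R) R (fun n => f n \_ D) a N :> (R -> R).
Proof.
apply/funext => x; rewrite L2_sumE /lin_comb; apply: eq_big_nat => n /andP[n1 _].
have -> : (a n *: fucik_L2 n) x = a n * fucik_L2 n x by [].
by rewrite fucik_L2E.
Qed.

(** The abstract results apply with [P] the even indices and [kappa] the squared norm pi / 2 of each
    sine. *)
Lemma fucik_riesz_basis : riesz_basis_0pi f.
Proof.
have ipP := L2_semi_inner_product mu0.
have kappa0 : 0 < pi / 2 :> R by rewrite divr_gt0// pi_gt0.
have odd_eq n : (0 < n)%N -> ~~ ~~ odd n -> fucik_L2 n = sine_L2 n.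
  by move=> _ /negPn; exact: fucik_L2_odd.
split.
- by move=> n n0; exact: fucik_system_Lfun.
- move=> g g2 e e0.
  have [N [a h]] := psi_dense _ ipP _ _ _ (fun n => ~~ odd n) kappa0 sine_L2_orth
    sine_L2_dense odd_eq fucik_L2_triangular fucik_L2_diag fucik_L2_close_tail
    (Lfun_Sub (lee1n 2) g2) _ e0.
  exists N, a; have := Lnorm2_lt _ _ _ h.
  rewrite (_ : EFin \o _ = EFin \o (g \- @lin_comb _ (measurableTypeR R) R
    (fun n => f n \_ D) a N)%R)//.
  by rewrite -lin_combE.
- have [C C0 HC] := psi_upper _ ipP _ _ _ (fun n => ~~ odd n) kappa0 sine_L2_orth
    odd_eq fucik_L2_close_tail.
  have [c c0 Hc] := psi_lower _ ipP _ _ _ (fun n => ~~ odd n) kappa0 sine_L2_orth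
    odd_eq fucik_L2_triangular fucik_L2_diag fucik_L2_close_tail.
  exists c, C; split=> // N a; rewrite -lin_combE Lnorm2_ip !lee_fin.
  by rewrite Hc HC.
Qed.

End fucik_system_properties.

Theorem theorem1p7 (R : realType) (alpha beta : nat -> R) (f : nat -> R -> R)
    (hF : fucik_system alpha beta f)
    (hodd : forall n : nat, odd n -> alpha n = n%:R ^+ 2 /\ beta n = n%:R ^+ 2)
    (hsum : (\sum_(2 <= n <oo)
       ((Num.max (Num.sqrt (alpha n)) (Num.sqrt (beta n)) / n%:R - 1) ^+ 2)%:E
         < +oo)%E) :
  riesz_basis_0pi f.
Proof. exact: (fucik_riesz_basis _ _ _ hF hodd hsum). Qed.
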